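(* For every $n\ge 1$, every $0<\varepsilon\le 1$, and every input $\{w_1,\dots,w_n\}$, $C$ to the 0/1 Knapsack counting problem, one can (deterministically) compute a floating-point number $Z$ of $2\log n+\log(1/\varepsilon)+1$ bits which satisfies $$(1-\varepsilon)\,s(n,C)\le Z\le s(n,C),$$ in time $$O\!\left(n^3\varepsilon^{-1}\left\lceil \frac{\log(1/\varepsilon)}{\log n}\right\rceil\right),$$ assuming unit cost additions and comparisons on numbers with $O(\log C)$ bits.
   Context: An input to the 0/1 Knapsack counting problem consists of $n$ nonnegative integer weights $w_1,\dots,w_n$ and an integer capacity $C$; $s(n,C)$ is the number of solutions, that is, the number of subsets of the $n$ items whose weights sum up to at most $C$. A floating-point number consists of an exponent $p$ and a mantissa of bits $x_1x_2\dots x_t$, and represents the value $2^p(x_1 2^{-1}+\dots+x_t2^{-t})$; here $\log n$ bits are used for the exponent and $t=1+\log(n/\varepsilon)$ bits for the mantissa. Logarithms are base 2.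
   Formalization: The factor ⌈log(1/ε)/log n⌉, which is 0 at ε=1 and undefined at n=1, is read as max(1,⌈log(1/ε)/log max(n,2)⌉); exponent and mantissa lengths are rounded up to integers and the exponent bits encode p−1; n and the weights also fit in a unit-cost word. *)

(* Defs.v *)
(* MathComp / MathComp-Analysis *)
From HB Require Import structures.
From mathcomp Require Import all_boot all_order all_algebra.
From mathcomp Require Import all_classical all_reals all_analysis.
Set Implicit Arguments.
Unset Strict Implicit.
Unset Printing Implicit Defensive.
Import Order.TTheory GRing.Theory Num.Theory.
Local Open Scope ring_scope.

Definition knapsack_count n (w : n.-tuple nat) (C : int) : nat :=
  #|[set S : {set 'I_n} | ((\sum_(i in S) tnth w i)%N%:Z <= C)%R]|.

Definition log2 (R : realType) (x : R) : R := ln x / ln 2.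

(* [Num.ceil] is int-valued; clog2 is only used at arguments x >= 1. *)
Definition clog2 (R : realType) (x : R) : nat := `|Num.ceil (log2 x)|%N.

(* The natural number written in binary by s, most significant bit first. *)
Definition bits_val (s : seq bool) : nat :=
  foldl (fun v (b : bool) => v.*2 + b)%N 0%N s.

Record float (k t : nat) := Float {
  fexp : k.-tuple bool;
  fman : t.-tuple bool }.

(* The exponent field is biased by 1: the k = clog2 n bits encode the exponents
   1 .. 2 ^ k, which include 1 .. n.  With an unbiased field no float would be
   close to 2 ^ n when n is a power of 2. *)
Definition fval (R : realType) k t (Z : float k t) : R :=
  2 ^+ (bits_val (fexp Z)).+1 *
    \sum_(i < t) (tnth (fman Z) i)%:R * 2 ^- i.+1.

(* Random-access machine: finitely many integer registers are named by the
   program; the memory is addressed indirectly, through a register. *)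
Record state := State { reg : nat -> int; mem : int -> int }.

Definition upd (T : eqType) (f : T -> int) (a : T) (v : int) : T -> int :=
  fun b => if b == a then v else f b.
Definition set_reg (s : state) x v := State (upd (reg s) x v) (mem s).
Definition set_mem (s : state) a v := State (reg s) (upd (mem s) a v).

Inductive cmd :=
| Skip
| Const of nat & int              (* r_x := c *)
| Add of nat & nat & nat          (* r_x := r_y + r_z *)
| Sub of nat & nat & nat          (* r_x := r_y - r_z *)
| Fetch of nat & nat              (* r_x := mem[r_y] *)
| Put of nat & nat                (* mem[r_x] := r_y *)
| Seq of cmd & cmd
| IfLt of nat & nat & cmd & cmd   (* if r_x < r_y *)
| WhileLt of nat & nat & cmd.     (* while r_x < r_y *)

Definition bitlen (m : nat) : nat := (trunc_log 2 m).+1.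

(* Number of W-bit words occupied by the integer x, never less than 1. *)
Definition words (W : nat) (x : int) : nat := ((bitlen `|x|%N).-1 %/ W).+1.

(* exec W c s s' k: started in s, c halts in s' after time k.  An instruction is
   charged one unit for each W-bit word of its operands, addresses and results;
   so it has unit cost, up to a constant, on numbers of O(W) bits. *)
Inductive exec (W : nat) : cmd -> state -> state -> nat -> Prop :=
| exec_skip s : exec W Skip s s 1
| exec_const s x c : exec W (Const x c) s (set_reg s x c) (words W c)
| exec_add s x y z (v := reg s y + reg s z) :
    exec W (Add x y z) s (set_reg s x v)
      (words W (reg s y) + words W (reg s z) + words W v)
| exec_sub s x y z (v := reg s y - reg s z) :
    exec W (Sub x y z) s (set_reg s x v)
      (words W (reg s y) + words W (reg s z) + words W v)
| exec_fetch s x y (v := mem s (reg s y)) :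
    exec W (Fetch x y) s (set_reg s x v) (words W (reg s y) + words W v)
| exec_put s x y :
    exec W (Put x y) s (set_mem s (reg s x) (reg s y))
      (words W (reg s x) + words W (reg s y))
| exec_seq c1 c2 s s1 s2 k1 k2 :
    exec W c1 s s1 k1 -> exec W c2 s1 s2 k2 ->
    exec W (Seq c1 c2) s s2 (k1 + k2)
| exec_if x y c1 c2 s s' k :
    exec W (if reg s x < reg s y then c1 else c2) s s' k ->
    exec W (IfLt x y c1 c2) s s' (words W (reg s x) + words W (reg s y) + k)
| exec_while_done x y c s :
    ~~ (reg s x < reg s y) ->
    exec W (WhileLt x y c) s s (words W (reg s x) + words W (reg s y))
| exec_while_step x y c s s1 s2 k1 k2 :
    reg s x < reg s y ->
    exec W c s s1 k1 -> exec W (WhileLt x y c) s1 s2 k2 ->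
    exec W (WhileLt x y c) s s2
      (words W (reg s x) + words W (reg s y) + k1 + k2).

Lemma exec_det W c s s1 k1 s2 k2 :
  exec W c s s1 k1 -> exec W c s s2 k2 -> s1 = s2 /\ k1 = k2.
Proof.
move=> H; elim: H s2 k2 => {c s s1 k1}; try by intros; inversion H.
- move=> c1 c2 s s1 s2 k1 k2 _ IH1 _ IH2 s3 k3 H.
  inversion H as [| | | | | |? ? ? t ? j1 j2 E1 E2| | |]; subst.
  by have [? ?] := IH1 _ _ E1; subst; have [-> ->] := IH2 _ _ E2.
- move=> x y c1 c2 s s1 k1 _ IH s2 k2 H.
  inversion H as [| | | | | | |? ? ? ? ? ? ? E| |]; subst.
  by have [-> ->] := IH _ _ E.
- move=> x y c s /negP Hn s2 k2 H.
  by inversion H.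
- move=> x y c s s1 s2 k1 k2 Hlt _ IH1 _ IH2 s3 k3 H.
  inversion H as [| | | | | | | |? ? ? ? Hn|? ? ? ? t ? j1 j2 _ E1 E2]; subst.
    by rewrite Hlt in Hn.
  by have [? ?] := IH1 _ _ E1; subst; have [-> ->] := IH2 _ _ E2.
Qed.

(* Digit of weight 2 ^- j in the binary expansion of e. *)
Definition digit (R : realType) (e : R) (j : nat) : int :=
  (Num.floor (2 ^+ j * e) %% 2)%Z.

(* Input: n, C, w_1, ..., w_n in the cells 0, 1, 2, ..., n + 1.  The real number
   e is given by its infinite binary expansion, with the digit of weight 2 ^- j
   in the cell - (j + 1).  All other cells and all registers contain 0. *)
Definition init (R : realType) n (w : n.-tuple nat) (C : int) (e : R) : state :=
  State (fun=> 0)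
    (fun a => match a with
              | Negz j => digit e j
              | Posz 0 => n%:Z
              | Posz 1 => C
              | Posz i.+2 => (nth 0%N w i)%:Z
              end).

(* A machine word is just long enough for n and for each number of the input;
   if no weight exceeds C, it has O(log n + log C) bits. *)
Definition word_size n (w : n.-tuple nat) (C : int) : nat :=
  bitlen (maxn (maxn n `|C|%N) (\max_(i < n) tnth w i)).

Definition output k t (s : state) (Z : float k t) : Prop :=
  reg s 0%N = (bits_val (fexp Z))%:Z /\ reg s 1%N = (bits_val (fman Z))%:Z.

(* The ceiling of log (1/e) / log n, made at least 1 (it vanishes for e = 1),
   and with 2 in place of n for n = 1, where log n = 0. *)
Definition log_factor (R : realType) (n : nat) (e : R) : nat :=
  maxn 1 `|Num.ceil (log2 e^-1 / log2 (maxn n 2)%:R)|%N.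

(* Main.v *)
(* Let M = 2 ^ m be the least power of 2 with M >= n / e.  For each prefix of i
   items and each level p = 0 .. n, an integer-valued function f(i,p) of the
   capacity underestimates the number s_i of solutions divided by 2 ^ p, by

     f(i+1,p)(c) = max (f(i,p)(c) + f(i,p)(c - w)) (min M (f(i+1,p-1)(c) / 2)).

   Level 0 is exact.  Where the scaled number is at most M, halving the previous
   level introduces no new error; where it is larger, the addition loses at most
   one unit, hence a factor 1 - 1/M.  So the error after n items, together with
   the final rounding down, is at most a factor (1 - 1/M) ^ n >= 1 - e.

   Only values below 2M matter, so f(i,p) is stored as the sorted list of its
   first 2M jump points.  Adding f and its translate by w is then a merge of two
   lists, halving keeps every second entry, and the maximum of two functions is
   the entrywise minimum.  No number has to be shifted, and each of the O(n^2)
   lists takes time O(M) = O(n / e).  The result is read at the least level whose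
   count is below 2M; its mantissa is normalised by repeated doubling. *)
Require Import Defs.
From HB Require Import structures.
From mathcomp Require Import all_boot all_order all_algebra.
From mathcomp Require Import all_classical all_reals all_analysis.
From mathcomp Require Import zify ring lra.
Set Implicit Arguments.
Unset Strict Implicit.
Unset Printing Implicit Defensive.
Import Order.TTheory GRing.Theory Num.Theory.
Local Open Scope ring_scope.

Local Notation "c1 ;; c2" := (Seq c1 c2) (at level 60, right associativity).

Local Notation "c1 ;; c2" := (Seq c1 c2) (at level 60, right associativity).

(** * Executions of bounded cost *)

Section Logic.
Variables (W X b : nat).
Hypothesis words_le : forall x : int, (`|x| <= X)%N -> (words W x <= b)%N.

Definition small (x : int) : Prop := (`|x| <= X)%N.

Definition all_small (s : state) : Prop :=
  (forall x, small (reg s x)) /\ (forall a, small (Defs.mem s a)).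

(* Costs are counted in units of b, which bounds the charge for one operand. *)
Definition runs (c : cmd) (s : state) (Q : state -> Prop) (N : nat) : Prop :=
  all_small s ->
  exists s' k, [/\ exec W c s s' k, (k <= N * b)%N, all_small s' & Q s'].

Lemma runs_seq c1 c2 s Q N1 N2 :
  runs c1 s (fun s1 => runs c2 s1 Q N2) N1 ->
  runs (c1 ;; c2) s Q (N1 + N2).
Proof.
move=> H1 /H1[s1 [k1 [E1 K1 S1]]] /(_ S1)[s2 [k2 [E2 K2 S2 HQ]]].
exists s2, (k1 + k2)%N; split=> //; first exact: exec_seq E1 E2.
by rewrite mulnDl leq_add.
Qed.

Lemma runs_weaken c s (Q Q' : state -> Prop) N N' :
  runs c s Q N -> (forall s', Q s' -> Q' s') -> (N <= N')%N -> runs c s Q' N'.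
Proof.
move=> H HQ leN /H[s' [k [E K S q]]]; exists s', k; split=> //; last exact: HQ.
by rewrite (leq_trans K) // leq_mul2r leN orbT.
Qed.

Lemma all_small_set_reg s x v : all_small s -> small v -> all_small (set_reg s x v).
Proof. by move=> [Hr Hm] Hv; split=> //= y; rewrite /upd; case: ifP. Qed.

Lemma all_small_set_mem s a v : all_small s -> small v -> all_small (Defs.set_mem s a v).
Proof. by move=> [Hr Hm] Hv; split=> //= y; rewrite /upd; case: ifP. Qed.

(** The index of the invariant is a variant: it bounds the iterations left and must be positive
    whenever the guard holds. Each test of the guard charges two operands, once per round and once
    more at the exit. *)
Lemma runs_while x y c (I : nat -> state -> Prop) B j s :
  (forall j s, I j s -> reg s x < reg s y ->
     (0 < j)%N /\ runs c s (I j.-1) B) ->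
  I j s ->
  runs (WhileLt x y c) s
    (fun s' => (exists j', I j' s') /\ reg s' y <= reg s' x) (j * (B + 2) + 2).
Proof.
move=> step; elim: j s => [|j IH] s Ij S; have [Sr _] := S;
  have Hw : (words W (reg s x) + words W (reg s y) <= 2 * b)%N
    by rewrite mul2n -addnn leq_add // words_le //; exact: Sr.
all: have [Hlt|Hge] := ltP (reg s x) (reg s y).
- by have [] := step _ _ Ij Hlt.
- exists s, (words W (reg s x) + words W (reg s y))%N; split=> //.
  + by apply: exec_while_done; rewrite -leNgt.
  + by split=> //; exists 0%N.
- have [_ /(_ S)[s1 [k1 [E1 K1 S1 I1]]]] := step _ _ Ij Hlt.
  have [s2 [k2 [E2 K2 S2 Q2]]] := IH _ I1 S1.
  exists s2, (words W (reg s x) + words W (reg s y) + k1 + k2)%N; split=> //.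
    exact: exec_while_step E1 E2.
  apply: leq_trans (leq_add (leq_add Hw K1) K2) _; nia.
- exists s, (words W (reg s x) + words W (reg s y))%N; split=> //.
  + by apply: exec_while_done; rewrite -leNgt.
  + by apply: leq_trans Hw _; rewrite leq_mul2r; apply/orP; right; lia.
  + by split=> //; exists j.+1.
Qed.

Lemma runs_if x y c1 c2 s Q N :
  (reg s x < reg s y -> runs c1 s Q N) ->
  (reg s y <= reg s x -> runs c2 s Q N) ->
  runs (IfLt x y c1 c2) s Q (N + 2).
Proof.
move=> H1 H2 S; have [Sr _] := S.
have Hw : (words W (reg s x) + words W (reg s y) <= 2 * b)%N
  by rewrite mul2n -addnn leq_add // words_le //; exact: Sr.
have [s' [k [E K S' q]]] : exists s' k,
    [/\ exec W (if reg s x < reg s y then c1 else c2) s s' k,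
        (k <= N * b)%N, all_small s' & Q s'].
  by case: ltP => h; [exact: H1 | exact: H2].
exists s', (words W (reg s x) + words W (reg s y) + k)%N; split=> //.
  exact: exec_if E.
by rewrite mulnDl addnC leq_add.
Qed.

(** The test is [Nat.eqb] rather than [==] so that [cbn] resolves each lookup of a literal
    register. *)
Definition updr (r : nat -> int) (x : nat) (v : int) : nat -> int :=
  fun y => if Nat.eqb y x then v else r y.

Lemma updrE r x v : updr r x v = upd r x v.
Proof.
apply/funext => y; rewrite /updr /upd.
suff -> : Nat.eqb y x = (y == x) by [].
by apply/idP/eqP => /PeanoNat.Nat.eqb_eq.
Qed.

(* Only arithmetic results have to be checked for size: all_small covers what
   is read from registers and memory. *)
Fixpoint wp (c : cmd) (r : nat -> int) (m : int -> int)
    (Q : (nat -> int) -> (int -> int) -> Prop) : Prop :=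
  match c with
  | Skip => Q r m
  | Const x v => small v /\ Q (updr r x v) m
  | Add x y z => small (r y + r z) /\ Q (updr r x (r y + r z)) m
  | Defs.Sub x y z => small (r y - r z) /\ Q (updr r x (r y - r z)) m
  | Fetch x y => Q (updr r x (m (r y))) m
  | Put x y => Q r (upd m (r x) (r y))
  | Defs.Seq c1 c2 => wp c1 r m (fun r m => wp c2 r m Q)
  | IfLt x y c1 c2 =>
      (r x < r y -> wp c1 r m Q) /\ (r y <= r x -> wp c2 r m Q)
  | WhileLt _ _ _ => False
  end.

(** No instruction charges more than three operands; a test charges two. *)
Fixpoint straight_cost (c : cmd) : nat :=
  match c with
  | Defs.Seq c1 c2 => straight_cost c1 + straight_cost c2
  | IfLt _ _ c1 c2 => maxn (straight_cost c1) (straight_cost c2) + 2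
  | _ => 3
  end.

Lemma runs_straight c s (Q : state -> Prop) :
  wp c (reg s) (Defs.mem s) (fun r m => Q (State r m)) ->
  runs c s Q (straight_cost c).
Proof.
elim: c s Q => [|x v|x y z|x y z|x y|x y|c1 IH1 c2 IH2|x y c1 IH1 c2 IH2|x y c1 IH1] s Q.
all: move=> /=.
- move=> q S; exists s, 1%N; split; [exact: exec_skip | | by [] | by case: (s) q].
  have : (0 < b)%N by apply: leq_trans (words_le (x := 0) isT).
  by rewrite mulSn; lia.
- case=> Hv q S; exists (set_reg s x v), (words W v); split.
  + exact: exec_const.
  + have := words_le Hv; lia.
  + exact: all_small_set_reg.
  + by rewrite /set_reg -updrE.
- case=> Hv q S; eexists; eexists; split.
  + exact: exec_add.
  + have := words_le Hv; have := words_le (S.1 y); have := words_le (S.1 z); lia.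
  + exact: all_small_set_reg.
  + by rewrite /set_reg -updrE.
- case=> Hv q S; eexists; eexists; split.
  + exact: exec_sub.
  + have := words_le Hv; have := words_le (S.1 y); have := words_le (S.1 z); lia.
  + exact: all_small_set_reg.
  + by rewrite /set_reg -updrE.
- move=> q S; eexists; eexists; split.
  + exact: exec_fetch.
  + have := words_le (S.1 y); have := words_le (S.2 (reg s y)); lia.
  + exact: all_small_set_reg (S.2 _).
  + by rewrite /set_reg -updrE.
- move=> q S; eexists; eexists; split.
  + exact: exec_put.
  + have := words_le (S.1 x); have := words_le (S.1 y); lia.
  + exact: all_small_set_mem (S.1 _).
  + by [].
- move=> H; apply: runs_seq.
  pose Q1 s1 := wp c2 (reg s1) (Defs.mem s1) (fun r m => Q (State r m)).
  by apply: (runs_weaken (IH1 s Q1 H)) => // s1; apply: IH2.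
- move=> [H1 H2]; apply: runs_if => h.
  + by apply: runs_weaken (IH1 _ _ (H1 h)) _ (leq_maxl _ _).
  + by apply: runs_weaken (IH2 _ _ (H2 h)) _ (leq_maxr _ _).
- by [].
Qed.

End Logic.

(** * The program *)

(** Register 24 is never written and serves as the constant 0; registers 0 and 1 receive the
    output. *)
Local Notation rZ := 24%N (only parsing).
Local Notation rN := 2%N (only parsing).
Local Notation rC := 3%N (only parsing).
Local Notation r1 := 4%N (only parsing).
Local Notation rDig := 5%N (only parsing).
Local Notation rV := 6%N (only parsing).
Local Notation rM := 7%N (only parsing).
Local Notation rL := 8%N (only parsing).
Local Notation rRow := 9%N (only parsing).
Local Notation rInf := 10%N (only parsing).
Local Notation rPtr := 11%N (only parsing).
Local Notation rEnd := 12%N (only parsing).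
Local Notation rItem := 13%N (only parsing).
Local Notation rBase := 14%N (only parsing).
Local Notation rW := 15%N (only parsing).
Local Notation rA := 16%N (only parsing).
Local Notation rB := 17%N (only parsing).
Local Notation rH := 18%N (only parsing).
Local Notation rLim := 19%N (only parsing).
Local Notation rBlk := 20%N (only parsing).
Local Notation rX := 21%N (only parsing).
Local Notation rY := 22%N (only parsing).
Local Notation rT := 23%N (only parsing).

(** [rC] receives [C + 1], so that the strict test [x < rC] decides [x <= C]. [rInf] is a finite
    stand-in for infinity. *)
Definition setup_code : cmd :=
  Const r1 1 ;; Fetch rN rZ ;; Fetch rC r1 ;; Add rC rC r1 ;;
  Add rInf rZ rC ;; IfLt rInf r1 (Add rInf rZ r1) Skip ;;
  Defs.Sub rDig rZ r1 ;; Fetch rV rDig ;; Add rM rZ r1.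

(** After [j] rounds [rV] is the integer part of [2 ^ j * e] and [rM] is [2 ^ j]. The former reaches
    [n] exactly when [2 ^ j >= n / e], so [M] is found without a division. *)
Definition digit_code : cmd :=
  Defs.Sub rDig rDig r1 ;; Fetch rX rDig ;; Add rV rV rV ;; Add rV rV rX ;;
  Add rM rM rM.

Definition size_code : cmd := Add rL rM rM ;; Add rRow rZ rL ;; Add rV rZ rZ.

(** Multiplication is not an instruction: the row length [n.+1 * L] is accumulated by [n]
    additions. *)
Definition row_size_code : cmd := Add rRow rRow rL ;; Add rV rV r1.

Definition base_code : cmd :=
  Add rBase rN r1 ;; Add rBase rBase r1 ;; Add rPtr rZ rBase ;;
  Add rEnd rBase rRow.

Definition fill_code : cmd := Put rPtr rInf ;; Add rPtr rPtr r1.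

(** [rA] and [rB] walk through the same block of the previous row; what is read through [rB] is
    shifted by the weight. *)
Definition pick_code : cmd :=
  Fetch rX rA ;; Fetch rY rB ;; Add rY rY rW ;;
  IfLt rY rX (Add rX rZ rY ;; Add rB rB r1) (Add rA rA r1).

(** The entries of odd index in the preceding block are the thresholds of its halved counts. There
    are [M] of them, so leaving that block at [rLim] realises the cap at [M]. *)
Definition halve_code : cmd :=
  IfLt rH rLim
    (Fetch rT rH ;; Add rH rH r1 ;; Add rH rH r1 ;;
     IfLt rT rX (Add rX rZ rT) Skip)
    Skip ;;
  Put rPtr rX ;; Add rPtr rPtr r1.

Definition cell_code : cmd := pick_code ;; halve_code.

Definition block_code : cmd :=
  (Defs.Sub rA rPtr rRow ;; Add rB rZ rA ;; Defs.Sub rH rPtr rL ;; Add rH rH r1 ;;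
   Add rLim rZ rPtr ;; Add rBlk rPtr rL) ;;
  WhileLt rPtr rBlk cell_code.

Definition row_code : cmd :=
  (Fetch rW rItem ;; Add rEnd rPtr rRow) ;;
  WhileLt rPtr rEnd block_code ;;
  Add rItem rItem r1.

(** The stored 0 encodes the empty selection: with no items, level 0 counts one solution from
    capacity 0 on. The weights occupy the addresses from 2 up to [rBase], so [rItem] is also the
    loop counter. *)
Definition table_code : cmd :=
  (Put rBase rZ ;; Const rItem 2) ;; WhileLt rItem rBase row_code.

Definition level_code : cmd :=
  Add rA rA rL ;; Add rB rB rL ;; Add rT rT r1 ;; Fetch rX rB.

Definition scan_code : cmd := Add rA rA r1 ;; Add rY rY r1 ;; Fetch rX rA.

Definition shift_code : cmd := Add rY rY rY ;; Defs.Sub rT rT r1.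

(** An exponent above [n] is replaced by [n] with the largest mantissa. One is subtracted because
    the exponent field is biased. *)
Definition write_code : cmd :=
  IfLt rN rT (Add rT rZ rN ;; Defs.Sub rY rL r1) Skip ;;
  Defs.Sub 0 rT r1 ;; Add 1 rZ rY.

Definition last_row_code : cmd :=
  Defs.Sub rA rPtr rRow ;; Add rB rA rL ;; Defs.Sub rB rB r1 ;;
  Add rT rZ rZ ;; Fetch rX rB.

Definition scan_init_code : cmd := Add rY rZ rZ ;; Fetch rX rA.

Definition float_code : cmd :=
  IfLt rZ rY
    (Defs.Sub rT rT rDig ;; WhileLt rY rM shift_code ;; write_code)
    (Add 0 rZ rZ ;; Add 1 rZ rZ).

Definition knapsack_code : cmd :=
  setup_code ;; WhileLt rV rN digit_code ;;
  size_code ;; WhileLt rV rN row_size_code ;;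
  base_code ;; WhileLt rPtr rEnd fill_code ;;
  table_code ;;
  last_row_code ;; WhileLt rX rC level_code ;;
  scan_init_code ;; WhileLt rX rC scan_code ;;
  float_code.

(** * Thresholds computed by the program *)

Section Machine.
Variables (W X b : nat).
Hypothesis words_le : forall x : int, (`|x| <= X)%N -> (words W x <= b)%N.

Variables (n m M wmax : nat) (wt : nat -> nat) (C : int) (mem0 : int -> int).
Local Notation L := (2 * M)%N.
Hypothesis M_pow : M = (2 ^ m)%N.
Hypothesis n_gt0 : (0 < n)%N.
Hypothesis wt_le : forall i, (wt i <= wmax)%N.
Hypothesis mem0_n : mem0 0 = n%:Z.
Hypothesis mem0_C : mem0 1 = C.
Hypothesis mem0_wt : forall i, (i < n)%N -> mem0 i.+2%:Z = (wt i)%:Z.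
Hypothesis mem0_cell : forall k, mem0 (n.+2 + k)%:Z = 0.
(** Stands for the integer part of [2 ^ j * e]. *)
Variable V : nat -> nat.
Hypothesis V_le : forall j, (V j.+1 <= 2 * V j + 1)%N.
Hypothesis V_lt : forall j, (V j < n)%N = (j < m)%N.
Hypothesis V_init : mem0 (- 1) = (V 0)%:Z.
Hypothesis V_rec : forall j, mem0 (- j.+2%:Z) = (V j.+1)%:Z - (2 * V j)%:Z.
Hypothesis X_ge : (n.+1 * n.+1 * L + 2 * n + 10 + `|C| + wmax <= X)%N.

(** The sentinel must exceed [C], and it stays positive for negative [C] because all entries are
    kept between 0 and [inf]. *)
Let inf : int := if C < 0 then 1 else C + 1.
Let inf_bounds : [/\ 0 < inf, C < inf & inf <= `|C|%N%:Z + 1].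
Proof. by rewrite /inf; case: (ltrP C 0) => h; split => //; lia. Qed.

(** With the rows laid end to end one recurrence covers all blocks: [n.+1] blocks back lies the same
    level of the previous row, one block back the previous level, or the last level of the previous
    row. *)
Variable F : nat -> int -> nat.
Hypothesis F_init : forall g c, (g <= n)%N -> F g c = ((g == 0)%N && (0 <= c)) :> nat.
Hypothesis F_rec : forall g c,
  F (g + n.+1)%N c =
  maxn (F g c + F g (c - (wt (g %/ n.+1))%:Z)) (minn M (F (g + n)%N c)./2).

Definition consts (r : nat -> int) : Prop :=
  [/\ r rZ = 0, r rN = n%:Z, r rC = C + 1, r r1 = 1 & r rDig = - m.+1%:Z] /\
  [/\ r rM = M%:Z, r rL = L%:Z, r rRow = (n.+1 * L)%:Z, r rInf = inf & r rBase = n.+2%:Z].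

Definition cell (k : nat) : int := (n.+2 + k)%:Z.

(* Block g occupies the L cells from cell (g * L) on.  If g = i * n.+1 + p, its
   q-th entry is the least capacity whose count for the first i items, at level
   p, exceeds q; only its comparisons with capacities c <= C are specified. *)
Definition mem_ok (P : nat) (mm : int -> int) : Prop :=
  [/\ forall a : int, a < n.+2%:Z -> mm a = mem0 a,
      forall k, 0 <= mm (cell k) <= inf
    & forall g q c, (q < L)%N -> (g * L + q < P)%N -> c <= C ->
        (mm (cell (g * L + q)) <= c) = (q < F g c)%N].

(* Every c <= C lies on the same side of both heads of the merge of a block
   with its translate by wi, so the smaller head is the next entry. *)
Definition merged (f : int -> nat) (wi : nat) (i j : nat) : Prop :=
  forall c : int, c <= C ->
    (i <= f c)%N && (j <= f (c - wi%:Z)%R)%N \/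
    (f c <= i)%N && (f (c - wi%:Z)%R <= j)%N.

(** A capacity of at least [x] has counts reaching both consumed prefixes; one below [x] is below
    [y] too, so neither count goes past its prefix. *)
Lemma merged_left f wi i j (x y : int) : merged f wi i j -> x <= y ->
  (forall c : int, c <= C -> (x <= c) = (i < f c)%N) ->
  (forall c : int, c <= C -> (y <= c) = (j < f (c - wi%:Z)%R)%N) ->
  merged f wi i.+1 j /\ (forall c : int, c <= C -> (x <= c) = (i + j < f c + f (c - wi%:Z)%R)%N).
Proof.
move=> H lexy Hx Hy; split=> c lec.
  by have := H c lec; have := Hx c lec; have := Hy c lec; lia.
by have := H c lec; have := Hx c lec; have := Hy c lec; lia.
Qed.

Lemma merged_right f wi i j (x y : int) : merged f wi i j -> y <= x ->
  (forall c : int, c <= C -> (x <= c) = (i < f c)%N) ->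
  (forall c : int, c <= C -> (y <= c) = (j < f (c - wi%:Z)%R)%N) ->
  merged f wi i j.+1 /\ (forall c : int, c <= C -> (y <= c) = (i + j < f c + f (c - wi%:Z)%R)%N).
Proof.
move=> H lexy Hx Hy; split=> c lec.
  by have := H c lec; have := Hx c lec; have := Hy c lec; lia.
by have := H c lec; have := Hx c lec; have := Hy c lec; lia.
Qed.

(** * Computation of one entry and of one block *)

Ltac regs := split=> //; try (split=> //); rewrite /cell; lia.

Lemma mem_ok_store g q mm v : (q < L)%N -> 0 <= v <= inf ->
  (forall c : int, c <= C -> (v <= c) = (q < F g c)%N) ->
  mem_ok (g * L + q) mm ->
  mem_ok (g * L + q).+1 (upd mm (cell (g * L + q)) v).
Proof.
move=> lt_q Hv HF [H1 H2 H3]; split=> [a lt_a|k|g' q' c lt_q' lt_P lec].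
- rewrite /upd; case: eqP => [E|_]; last exact: H1.
  by move: lt_a; rewrite E /cell; lia.
- by rewrite /upd; case: eqP.
rewrite /upd; case: eqP => [E|ne].
  have E' : (g' * L + q' = g * L + q)%N by move: E; rewrite /cell; lia.
  have Eg : g' = g by nia.
  have -> : q' = q by nia.
  by rewrite Eg HF.
apply: H3 => //; move: ne; rewrite /cell; lia.
Qed.

(** [i] and [k] are the numbers of entries consumed from the two merged lists. The halving pointer
    advances by two per entry until it leaves its block after [M] entries, hence [minn q M]. *)
Definition cell_pre (g q i k : nat) (vEnd vItem : int) (s : state) : Prop :=
  [/\ consts (reg s), mem_ok ((g + n.+1) * L + q) (Defs.mem s),
      merged (F g) (wt (g %/ n.+1)) i k &
  [/\ reg s rEnd = vEnd, reg s rItem = vItem & reg s rW = (wt (g %/ n.+1))%:Z] /\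
  [/\ reg s rPtr = cell ((g + n.+1) * L + q) /\ reg s rA = cell (g * L + i),
      reg s rB = cell (g * L + k),
      reg s rH = cell ((g + n) * L + 2 * minn q M + 1),
      reg s rLim = cell ((g + n.+1) * L)
    & reg s rBlk = cell ((g + n.+1) * L + L)]].

Lemma pick_step g q i k vEnd vItem s : (g < n * n.+1)%N -> (q < L)%N ->
  (i + k = q)%N -> cell_pre g q i k vEnd vItem s ->
  runs W X b pick_code s (fun s' => exists i' k',
    [/\ (i' + k' = q.+1)%N, cell_pre g q i' k' vEnd vItem s',
     0 <= reg s' rX <= inf &
     forall c : int, c <= C ->
       (reg s' rX <= c) = (q < F g c + F g (c - (wt (g %/ n.+1))%:Z)%R)%N]) 17.
Proof.
move=> lt_g lt_q Hq [Hc Hm Hmg [[H12 H13 H15] [[H11 H16] H17 H18 H19 H20]]].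
apply: (runs_weaken (N := straight_cost pick_code)); [|move=> s'; exact: id|by []].
apply: runs_straight => //.
case: s Hc Hm H12 H13 H15 H11 H16 H17 H18 H19 H20 => r mm /=.
move=> Hc Hm H12 H13 H15 H11 H16 H17 H18 H19 H20.
have [[h24 h2 h3 h4 h5] [h7 h8 h9 h10 h14]] := Hc.
have [Hm1 Hm2 Hm3] := Hm.
have Ha := Hm2 (g * L + i)%N; have Hb := Hm2 (g * L + k)%N.
have [i0 i1 i2] := inf_bounds; have Hw := wt_le (g %/ n.+1).
have ltP : ((g + n.+1) * L + L <= n.+1 * n.+1 * L)%N by nia.
have Hx : forall c : int, c <= C -> (mm (cell (g * L + i)) <= c) = (i < F g c)%N.
  by move=> c; apply: Hm3; nia.
have Hy : forall c : int, c <= C -> (mm (cell (g * L + k)) + (wt (g %/ n.+1))%:Z <= c) =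
    (k < F g (c - (wt (g %/ n.+1))%:Z)%R)%N.
  by move=> c lec; rewrite -lerBrDr; apply: Hm3; nia.
rewrite /pick_code; cbn [wp updr Nat.eqb reg Defs.mem].
rewrite !H16 !H17 !H15 !h24 !h4.
split; first by rewrite /small; lia.
split=> lexy.
  split; first by rewrite /small; lia.
  split; first by rewrite /small /cell; lia.
  have [Hm' Hs] := merged_right Hmg (ltW lexy) Hx Hy.
  exists i, k.+1; rewrite /cell_pre; cbn [updr Nat.eqb reg Defs.mem]; split => //; first by lia.
  - split => //; split => //; split => //; rewrite /cell; lia.
  - lia.
  - by move=> c /Hs E; rewrite add0r E Hq.
split; first by rewrite /small /cell; lia.
have [Hm' Hs] := merged_left Hmg lexy Hx Hy.
exists i.+1, k; rewrite /cell_pre; cbn [updr Nat.eqb reg Defs.mem]; split => //; first by lia.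
- split => //; split => //; regs.
- by move=> c /Hs E; rewrite E Hq.
Qed.

Lemma halve_step g q i k vEnd vItem s : (g < n * n.+1)%N -> (q < L)%N ->
  cell_pre g q i k vEnd vItem s -> 0 <= reg s rX <= inf ->
  (forall c : int, c <= C ->
       (reg s rX <= c) = (q < F g c + F g (c - (wt (g %/ n.+1))%:Z)%R)%N) ->
  runs W X b halve_code s (cell_pre g q.+1 i k vEnd vItem) 22.
Proof.
move=> lt_g lt_q [Hc Hm Hmg [[H12 H13 H15] [[H11 H16] H17 H18 H19 H20]]].
move=> Hx1 Hx2.
apply: (runs_weaken (N := straight_cost halve_code)); [|move=> s'; exact: id|by []].
apply: runs_straight => //.
case: s Hc Hm H12 H13 H15 H11 H16 H17 H18 H19 H20 Hx1 Hx2 => r mm /=.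
move=> Hc Hm H12 H13 H15 H11 H16 H17 H18 H19 H20 Hx1 Hx2.
have [[h24 h2 h3 h4 h5] [h7 h8 h9 h10 h14]] := Hc.
have [Hm1 Hm2 Hm3] := Hm.
have Hh := Hm2 ((g + n) * L + 2 * minn q M + 1)%N.
have [i0 i1 i2] := inf_bounds.
have ltP : ((g + n.+1) * L + L <= n.+1 * n.+1 * L)%N by nia.
have eL : ((g + n.+1) * L = (g + n) * L + L)%N by nia.
have Hs1 : small X (cell ((g + n.+1) * L + q) + 1) by rewrite /small /cell; lia.
(* Whichever value is stored, only its threshold property remains to be checked. *)
have close v : 0 <= v <= inf ->
    (forall c : int, c <= C -> (v <= c) = (q < F (g + n.+1)%N c)%N) ->
    mem_ok ((g + n.+1) * L + q.+1) (upd mm (cell ((g + n.+1) * L + q)) v).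
  by move=> Hv1 Hv2; rewrite addnS; apply: mem_ok_store.
rewrite /halve_code; cbn [wp updr Nat.eqb reg Defs.mem].
rewrite !H18 !H19 !h24 !h4 !H11.
split=> [lt_h|ge_h].
  have ltqM : (q < M)%N by move: lt_h; rewrite /cell; lia.
  (* Half a count exceeds [q] exactly when the count exceeds [2 * q + 1]; as [q < M], this survives
     the cap at [M]. *)
  have Hy : forall c : int, c <= C ->
      (mm (cell ((g + n) * L + 2 * minn q M + 1)) <= c) = (q < minn M (F (g + n)%N c)./2)%N.
    move=> c lec; rewrite -addnA Hm3 //; lia.
  split; first by rewrite /small /cell; lia.
  split; first by rewrite /small /cell; lia.
  (* The smaller of two thresholds is the threshold of the larger count. *)
  split=> lexh.
    split; first by rewrite /small; lia.
    split => //; split; cbn [updr Nat.eqb reg Defs.mem] => //.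
      apply: close => [|c lec]; first by lia.
      by have := Hx2 c lec; have := Hy c lec; rewrite add0r F_rec; lia.
    split; first by split.
    regs.
  split => //; split; cbn [updr Nat.eqb reg Defs.mem] => //.
    apply: close => [|c lec]; first by lia.
    by have := Hx2 c lec; have := Hy c lec; rewrite F_rec; lia.
  split; first by split.
  regs.
(* The halved count is capped at [M <= q], so it cannot exceed [q], and the merged entry stands. *)
have leMq : (M <= q)%N by move: ge_h; rewrite /cell; lia.
split => //; split; cbn [updr Nat.eqb reg Defs.mem] => //.
  apply: close => [|c lec]; first by lia.
  by have := Hx2 c lec; rewrite F_rec; lia.
split; first by split.
split=> //; rewrite ?H18 /cell; first split=> //; lia.
Qed.

Definition cell_inv (g : nat) (vEnd vItem : int) (j : nat) (s : state) : Prop :=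
  exists q i k, [/\ (q + j = L)%N, (i + k = q)%N & cell_pre g q i k vEnd vItem s].

Lemma cell_step g vEnd vItem j s : (g < n * n.+1)%N ->
  cell_inv g vEnd vItem j s -> reg s rPtr < reg s rBlk ->
  (0 < j)%N /\ runs W X b cell_code s (cell_inv g vEnd vItem j.-1) 39.
Proof.
move=> lt_g [q [i [k [Hj Hq Hpre]]]] lt_q.
have {}lt_q : (q < L)%N.
  by case: Hpre lt_q => _ _ _ [_ [[-> _] _ _ _ ->]]; rewrite /cell; lia.
split; first by lia.
apply: (runs_seq (N1 := 17) (N2 := 22)).
apply: runs_weaken (pick_step lt_g lt_q Hq Hpre) _ (leqnn _).
move=> s1 [i' [k' [Hik Hpre1 Hx Hc]]].
apply: runs_weaken (halve_step lt_g lt_q Hpre1 Hx Hc) _ (leqnn _).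
by move=> s2 Hpre2; exists q.+1, i', k'; split => //; lia.
Qed.

Definition row_pre (g : nat) (vEnd vItem : int) (wi : nat) (s : state) : Prop :=
  [/\ consts (reg s), mem_ok (g * L) (Defs.mem s) &
  [/\ reg s rEnd = vEnd, reg s rItem = vItem, reg s rW = wi%:Z
    & reg s rPtr = cell (g * L)]].

Lemma block_step g vEnd vItem s : (g < n * n.+1)%N ->
  row_pre (g + n.+1) vEnd vItem (wt (g %/ n.+1)) s ->
  runs W X b block_code s
    (row_pre (g + n.+1).+1 vEnd vItem (wt (g %/ n.+1))) (82 * M + 20).
Proof.
move=> lt_g [Hc Hm [H12 H13 H15 H11]].
have -> : (82 * M + 20 = 18 + (L * (39 + 2) + 2))%N by lia.
have [i0 i1 i2] := inf_bounds.
have ltP : ((g + n.+1) * L + L <= n.+1 * n.+1 * L)%N by nia.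
have eS : ((g + n.+1) * L = g * L + n.+1 * L)%N by nia.
have eL : ((g + n.+1) * L = (g + n) * L + L)%N by nia.
apply: runs_seq; apply: (runs_weaken (Q := cell_inv g vEnd vItem L)); last 1 first.
- exact: leqnn.
- apply: runs_straight => //.
  case: s Hc Hm H12 H13 H15 H11 => r mm /= Hc Hm H12 H13 H15 H11.
  have [[h24 h2 h3 h4 h5] [h7 h8 h9 h10 h14]] := Hc.
  cbn [wp updr Nat.eqb reg Defs.mem]; rewrite !H11 !h9 !h24 !h8 !h4.
  split; first by rewrite /small /cell; lia.
  split; first by rewrite /small /cell; lia.
  split; first by rewrite /small /cell; lia.
  split; first by rewrite /small /cell; lia.
  split; first by rewrite /small /cell; lia.
  split; first by rewrite /small /cell; lia.
  exists 0%N, 0%N, 0%N; split => //; split; cbn [updr Nat.eqb reg Defs.mem] => //.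
  + by rewrite addn0.
  + by move=> c lec; left; rewrite !leq0n.
  + by split=> //; split; rewrite ?H11 /cell; try split; lia.
move=> s1 Hs1.
apply: runs_weaken (runs_while words_le _ Hs1) _ (leqnn _).
  by move=> j s2; apply: cell_step.
move=> s2 [[j [q [i [k [Hj Hq [Hc2 Hm2 _ [[K12 K13 K15] [[K11 _] _ _ _ K20]]]]]]]]].
rewrite K11 K20 /cell => le_q.
have Eq : q = L by lia.
move: Hm2 K11; rewrite Eq -mulSnr => Hm2 K11.
by split.
Qed.
Let lt_mM : (m < M)%N.
Proof. by rewrite M_pow ltn_expl. Qed.

(** * Rows and the whole table *)

Definition blocks_inv (i j : nat) (s : state) : Prop :=
  exists g, [/\ (i.+1 * n.+1 <= g)%N, (g + j = i.+2 * n.+1)%N &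
    row_pre g (cell (i.+2 * n.+1 * L)) i.+2%:Z (wt i) s].

Definition table_pre (i : nat) (s : state) : Prop :=
  [/\ consts (reg s), mem_ok (i.+1 * n.+1 * L) (Defs.mem s),
      reg s rItem = i.+2%:Z & reg s rPtr = cell (i.+1 * n.+1 * L)].

Lemma row_step i s : (i < n)%N -> table_pre i s ->
  runs W X b row_code s (table_pre i.+1) (n.+1 * (82 * M + 22) + 11).
Proof.
move=> lt_i [Hc Hm H13 H11].
have -> : (n.+1 * (82 * M + 22) + 11 = 6 + ((n.+1 * (82 * M + 20 + 2) + 2) + 3))%N by lia.
have ltR : (i.+2 * n.+1 * L <= n.+1 * n.+1 * L)%N by rewrite !leq_mul2r; lia.
have eR : (i.+2 * n.+1 * L = i.+1 * n.+1 * L + n.+1 * L)%N by nia.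
apply: runs_seq; apply: (runs_weaken (Q := blocks_inv i n.+1)); last 1 first.
- exact: leqnn.
- apply: runs_straight => //.
  case: s Hc Hm H13 H11 => r mm /= Hc Hm H13 H11.
  have [[h24 h2 h3 h4 h5] [h7 h8 h9 h10 h14]] := Hc.
  cbn [wp updr Nat.eqb reg Defs.mem]; rewrite !H11 !h9 !H13.
  split; first by rewrite /small /cell; lia.
  exists (i.+1 * n.+1)%N; split => //; first by lia.
  split => //; cbn [updr Nat.eqb reg Defs.mem] => //; split => //.
    rewrite /cell; lia.
  by case: Hm => Hm1 _ _; rewrite Hm1 ?mem0_wt //; lia.
move=> s1 Hs1; apply: runs_seq.
apply: runs_weaken (runs_while words_le (B := (82 * M + 20)%N) _ Hs1) _ (leqnn _).
  move=> j s2 [g [le_g eq_g Hpre]].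
  have [_ _ [-> _ _ ->]] := Hpre; rewrite /cell => ltg.
  have lt_g : (g < i.+2 * n.+1)%N.
    by rewrite ltnNge; apply/negP => h; have := leq_mul h (leqnn L); lia.
  split; first by lia.
  (* The block at the same level in the previous row, that is, in row [i]. *)
  pose g' := (g - n.+1)%N; have Eg : g = (g' + n.+1)%N by rewrite /g'; lia.
  have Ei : (g' %/ n.+1 = i)%N.
    by apply/eqP; rewrite eqn_leq -ltnS ltn_divLR // leq_divRL //; nia.
  move: Hpre; rewrite -[in wt i]Ei Eg => Hpre.
  have lt_g' : (g' < n * n.+1)%N by nia.
  apply: runs_weaken (block_step lt_g' Hpre) _ (leqnn _) => s3; rewrite Ei => H3.
  by exists (g' + n.+1).+1; split => //; lia.
move=> s2 [[j [g [le_g eq_g [Hc2 Hm2 [K12 K13 K15 K11]]]]]].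
rewrite K11 K12 /cell => le_end.
have Eg : g = (i.+2 * n.+1)%N.
  have : (i.+2 * n.+1 <= g)%N.
    by rewrite leqNgt; apply/negP => h; have := leq_mul h (leqnn L); lia.
  by lia.
rewrite Eg in Hm2 K11.
apply: runs_straight => //.
case: s2 Hc2 Hm2 K11 K12 K13 K15 le_end => r mm /= Hc2 Hm2 K11 K12 K13 K15 le_end.
have [[h24 h2 h3 h4 h5] [h7 h8 h9 h10 h14]] := Hc2.
cbn [wp updr Nat.eqb reg Defs.mem]; rewrite K13 h4.
split; first by rewrite /small; lia.
by split; cbn [updr Nat.eqb reg Defs.mem] => //; lia.
Qed.

Definition filled (s : state) : Prop :=
  consts (reg s) /\
  [/\ forall a : int, a < n.+2%:Z -> Defs.mem s a = mem0 a,
      forall k, 0 <= Defs.mem s (cell k) <= inf,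
      forall k, (k < n.+1 * L)%N -> Defs.mem s (cell k) = inf
    & reg s rPtr = cell (n.+1 * L)].

Lemma table_run s : filled s ->
  runs W X b table_code s (table_pre n) (n * (n.+1 * (82 * M + 22) + 13) + 8).
Proof.
move=> [Hc [Hm1 Hm2 Hm3 H11]].
have -> : (n * (n.+1 * (82 * M + 22) + 13) + 8 =
  6 + (n * (n.+1 * (82 * M + 22) + 11 + 2) + 2))%N by lia.
have [i0 i1 i2] := inf_bounds.
apply: runs_seq; apply: (runs_weaken (Q := table_pre 0)); last 1 first.
- exact: leqnn.
- apply: runs_straight => //.
  case: s Hc Hm1 Hm2 Hm3 H11 => r mm /= Hc Hm1 Hm2 Hm3 H11.
  have [[h24 h2 h3 h4 h5] [h7 h8 h9 h10 h14]] := Hc.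
  cbn [wp updr Nat.eqb reg Defs.mem]; rewrite !h14 !h24.
  split; first by rewrite /small; lia.
  split; cbn [updr Nat.eqb reg Defs.mem] => //; last by rewrite H11 mul1n.
  split=> [a lt_a|k|g q c lt_q lt_g lec].
  + by rewrite /upd; case: eqP => [E|_]; [lia | exact: Hm1].
  + by rewrite /upd; case: eqP => // _; lia.
  + have lt_gn : (g <= n)%N.
      by rewrite -ltnS ltnNge; apply/negP => h; have := leq_mul h (leqnn L); lia.
    (* The cell set to 0 is entry 0 of block 0. Elsewhere the sentinel exceeds every [c <= C], in
       agreement with [F g c <= q]. *)
    rewrite F_init // /upd; case: eqP => [E|ne].
      have [-> ->] : g = 0%N /\ q = 0%N by move: E lt_q; rewrite /cell; nia.
      by rewrite eqxx /=; case: (0 <= c).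
    rewrite mul1n in lt_g; rewrite Hm3 //.
    rewrite leNgt (le_lt_trans lec i1) /=; symmetry.
    case: eqP => // Eg; have : q != 0%N by apply/eqP => Eq; apply: ne; rewrite Eg Eq /cell; lia.
    by case: q {lt_q lt_g ne} => // q _; case: (0 <= c).
move=> s1 Hs1.
pose I j s := exists i, (i + j = n)%N /\ table_pre i s.
apply: runs_weaken (runs_while words_le (I := I) (j := n) (B := (n.+1 * (82 * M + 22) + 11)%N) _ _) _ (leqnn _).
- move=> j s2 [i [Ei Hi]].
  have [Hc2 _ -> _] := Hi; have [_ [_ _ _ _ ->]] := Hc2 => lt_i.
  split; first by lia.
  apply: runs_weaken (row_step _ Hi) _ (leqnn _); first by lia.
  by move=> s3 H3; exists i.+1; split => //; lia.
- by exists 0%N; split.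
move=> s2 [[j [i [Ei Hi]]]].
have [Hc2 _ -> _] := Hi; have [_ [_ _ _ _ ->]] := Hc2 => ge_i.
by have <- : i = n by lia.
Qed.

(** * Setup: the precision [M], the row length and the initial row *)

Definition digit_inv (j : nat) (s : state) : Prop :=
  [/\ (j <= m)%N, Defs.mem s = mem0 &
  [/\ reg s rZ = 0, reg s rN = n%:Z, reg s rC = C + 1, reg s r1 = 1
    & reg s rInf = inf] /\
  [/\ reg s rDig = - j.+1%:Z, reg s rV = (V j)%:Z & reg s rM = (2 ^ j)%N%:Z]].

Lemma setup_run s : reg s = (fun=> 0) -> Defs.mem s = mem0 ->
  runs W X b setup_code s (digit_inv 0) 29.
Proof.
move=> Hr Hm; apply: runs_straight => //.
rewrite Hr Hm; rewrite /setup_code; cbn [wp updr Nat.eqb reg Defs.mem]; rewrite mem0_n mem0_C.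
have [i0 i1 i2] := inf_bounds.
split; first by rewrite /small; lia.
split; first by rewrite /small; lia.
split; first by rewrite /small; lia.
split=> lt_C.
  split; first by rewrite /small; lia.
  split; first by rewrite /small; lia.
  split; first by rewrite /small; lia.
  split=> //; cbn [updr Nat.eqb reg Defs.mem]; split=> //.
  by split=> //; rewrite /inf; case: ltrP => h; lia.
split; first by rewrite /small; lia.
split; first by rewrite /small; lia.
split=> //; cbn [updr Nat.eqb reg Defs.mem]; split=> //.
by split=> //; rewrite /inf; case: ltrP => h; lia.
Qed.

Definition level_size (s : state) : Prop :=
  [/\ Defs.mem s = mem0,
  [/\ reg s rZ = 0, reg s rN = n%:Z, reg s rC = C + 1, reg s r1 = 1
    & reg s rInf = inf], reg s rDig = - m.+1%:Z & reg s rM = M%:Z].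

Lemma digit_run s : digit_inv 0 s ->
  runs W X b (WhileLt rV rN digit_code) s level_size (m * 17 + 2).
Proof.
move=> H0.
pose I k s := exists j, (j + k = m)%N /\ digit_inv j s.
apply: runs_weaken (runs_while words_le (I := I) (j := m) (B := 15%N) _ _) _ _ => //.
- move=> k {}s {H0} [j [Ej [le_j Hm [[h24 h2 h3 h4 h10] [h5 h6 h7]]]]].
  rewrite h6 h2 => lt_V; have lt_j : (j < m)%N by rewrite -V_lt; lia.
  split; first by lia.
  apply: runs_straight => //.
  case: s Hm h24 h2 h3 h4 h10 h5 h6 h7 => r mm /= -> h24 h2 h3 h4 h10 h5 h6 h7.
  rewrite /digit_code; cbn [wp updr Nat.eqb reg Defs.mem]; rewrite h5 h4 h6 h7.
  have -> : - j.+1%:Z - 1 = - j.+2%:Z by lia.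
  (* The guard [V j < n] keeps the doubled value within the size bound. *)
  rewrite V_rec; have := V_le j => le_V.
  have e2 : (2 ^ j.+1 = 2 ^ j + 2 ^ j)%N by rewrite expnS; lia.
  have le2 : (2 ^ j.+1 <= M)%N by rewrite M_pow leq_pexp2l.
  have leMX : (M <= n.+1 * n.+1 * L)%N by nia.
  split; first by rewrite /small; lia.
  split; first by rewrite /small; lia.
  split; first by rewrite /small; lia.
  split; first by rewrite /small; lia.
  exists j.+1; split; first by lia.
  split => //; cbn [updr Nat.eqb reg Defs.mem]; split=> //.
  by split=> //; lia.
- by exists 0%N.
move=> s1 [[k [j [Ej [le_j Hm [Hc [h5 h6 h7]]]]]]].
have [h24 h2 h3 h4 h10] := Hc; rewrite h6 h2 => ge_V.
have Em : j = m by have := V_lt j; lia.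
by split => //; rewrite ?h7 ?h5 ?Em ?M_pow.
Qed.

Definition row_size (i : nat) (s : state) : Prop :=
  level_size s /\
  [/\ reg s rL = L%:Z, reg s rRow = (i.+1 * L)%N%:Z & reg s rV = i%:Z].

Lemma size_run s : level_size s -> runs W X b size_code s (row_size 0) 9.
Proof.
move=> [Hm [h24 h2 h3 h4 h10] h5 h7]; apply: runs_straight => //.
case: s Hm h24 h2 h3 h4 h10 h5 h7 => r mm /= -> h24 h2 h3 h4 h10 h5 h7.
rewrite /size_code; cbn [wp updr Nat.eqb reg Defs.mem]; rewrite !h7 !h24.
have leMX : (L <= n.+1 * n.+1 * L)%N by nia.
split; first by rewrite /small; lia.
split; first by rewrite /small; lia.
split; first by rewrite /small; lia.
by split; split; cbn [updr Nat.eqb reg Defs.mem]; [ | split | | | | | ] => //; lia.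
Qed.

Lemma row_size_run s : row_size 0 s ->
  runs W X b (WhileLt rV rN row_size_code) s (row_size n) (n * 8 + 2).
Proof.
move=> H0.
pose I k s := exists i, (i + k = n)%N /\ row_size i s.
apply: runs_weaken (runs_while words_le (I := I) (j := n) (B := 6%N) _ _) _ _ => //.
- move=> k {}s {H0} [i [Ei [[Hm [h24 h2 h3 h4 h10] h5 h7] [h8 h9 h6]]]].
  rewrite h6 h2 => lt_i; split; first by lia.
  apply: runs_straight => //.
  case: s Hm h24 h2 h3 h4 h10 h5 h7 h8 h9 h6 => r mm /= -> h24 h2 h3 h4 h10 h5 h7 h8 h9 h6.
  rewrite /row_size_code; cbn [wp updr Nat.eqb reg Defs.mem]; rewrite !h9 !h8 !h6 !h4.
  have leX : (i.+2 * L <= n.+1 * n.+1 * L)%N by rewrite leq_mul2r; nia.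
  split; first by rewrite /small; lia.
  split; first by rewrite /small; lia.
  exists i.+1; split; first by lia.
  by split; split; cbn [updr Nat.eqb reg Defs.mem]; [ | split | | | | | ] => //; lia.
- by exists 0%N.
move=> s1 [[k [i [Ei Hi]]]].
have [[_ [_ h2 _ _ _] _ _] [_ _ h6]] := Hi; rewrite h6 h2 => ge_i.
by have <- : i = n by lia.
Qed.

Definition fill_inv (k : nat) (s : state) : Prop :=
  consts (reg s) /\
  [/\ forall a : int, a < n.+2%:Z -> Defs.mem s a = mem0 a,
      forall k, 0 <= Defs.mem s (cell k) <= inf,
      forall k', (k' < k)%N -> Defs.mem s (cell k') = inf
    & reg s rPtr = cell k /\ reg s rEnd = cell (n.+1 * L)].

Lemma base_run s : row_size n s -> runs W X b base_code s (fill_inv 0) 12.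
Proof.
move=> [[Hm [h24 h2 h3 h4 h10] h5 h7] [h8 h9 h6]].
apply: runs_straight => //.
case: s Hm h24 h2 h3 h4 h10 h5 h7 h8 h9 h6 => r mm /= -> h24 h2 h3 h4 h10 h5 h7 h8 h9 h6.
rewrite /base_code; cbn [wp updr Nat.eqb reg Defs.mem]; rewrite !h2 !h9 !h4 !h24.
have leX : (n.+1 * L <= n.+1 * n.+1 * L)%N by rewrite leq_mul2r; nia.
split; first by rewrite /small; lia.
split; first by rewrite /small; lia.
split; first by rewrite /small; lia.
split; first by rewrite /small; lia.
have [i0 i1 i2] := inf_bounds.
split; first by split; split; cbn [updr Nat.eqb reg Defs.mem] => //; lia.
split; cbn [updr Nat.eqb reg Defs.mem] => //.
- by move=> k; rewrite /cell mem0_cell lexx ltW.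
- by rewrite /cell; split; lia.
Qed.

Lemma fill_run s : fill_inv 0 s ->
  runs W X b (WhileLt rPtr rEnd fill_code) s filled (n.+1 * L * 8 + 2).
Proof.
move=> H0.
have [i0 i1 i2] := inf_bounds.
pose I k s := exists i, (i + k = n.+1 * L)%N /\ fill_inv i s.
apply: runs_weaken (runs_while words_le (I := I) (j := (n.+1 * L)%N) (B := 6%N) _ _) _ _ => //.
- move=> k {}s {H0} [i [Ei [Hc [Hm1 Hm2 Hm3 [h11 h12]]]]].
  rewrite h11 h12 /cell => lt_i; split; first by lia.
  apply: runs_straight => //.
  case: s Hc Hm1 Hm2 Hm3 h11 h12 => r mm /= Hc Hm1 Hm2 Hm3 h11 h12.
  have [[h24 h2 h3 h4 h5] [h7 h8 h9 h10 h14]] := Hc.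
  rewrite /fill_code; cbn [wp updr Nat.eqb reg Defs.mem]; rewrite !h11 !h4 !h10.
  have leX : (n.+1 * L <= n.+1 * n.+1 * L)%N by rewrite leq_mul2r; nia.
  split; first by rewrite /small /cell; lia.
  exists i.+1; split; first by lia.
  split=> //; split; cbn [updr Nat.eqb reg Defs.mem].
  + move=> a lt_a; rewrite /upd; case: eqP => [E|_]; last exact: Hm1.
    by move: E; rewrite /cell; lia.
  + by move=> k'; rewrite /upd; case: eqP => // _; lia.
  + move=> k' lt_k'; rewrite /upd; case: eqP => // ne; apply: Hm3.
    by move: ne; rewrite /cell; lia.
  + by split=> //; rewrite /cell; lia.
- by exists 0%N.
move=> s1 [[k [i [Ei [Hc [Hm1 Hm2 Hm3 [h11 h12]]]]]]].
rewrite h11 h12 /cell => ge_i.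
have Ek : i = (n.+1 * L)%N by lia.
by split=> //; split=> //; rewrite -Ek.
Qed.

(** * Reading the result off the last row *)

Local Notation count p := (F (n * n.+1 + p)%N C).
Hypothesis count_last : (count n < L)%N.

Definition level_inv (p : nat) (s : state) : Prop :=
  [/\ consts (reg s), mem_ok (n.+1 * n.+1 * L) (Defs.mem s),
      (p <= n)%N /\ (forall p', (p' < p)%N -> (L <= count p')%N) &
  [/\ reg s rA = cell ((n * n.+1 + p) * L),
      reg s rB = cell ((n * n.+1 + p) * L + (L - 1)), reg s rT = p%:Z
    & reg s rX = Defs.mem s (reg s rB)]].

Let level_bound p : (p <= n)%N -> ((n * n.+1 + p) * L + L <= n.+1 * n.+1 * L)%N.
Proof. by move=> le_p; rewrite -mulSnr leq_mul2r; apply/orP; right; lia. Qed.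

Let M_gt0 : (0 < M)%N.
Proof. by rewrite M_pow expn_gt0. Qed.

Lemma last_row_run s : table_pre n s ->
  runs W X b last_row_code s (level_inv 0) 15.
Proof.
move=> [Hc Hm H13 H11]; apply: runs_straight => //.
case: s Hc Hm H13 H11 => r mm /= Hc Hm H13 H11.
have [[h24 h2 h3 h4 h5] [h7 h8 h9 h10 h14]] := Hc.
rewrite /last_row_code; cbn [wp updr Nat.eqb reg Defs.mem].
have lb := level_bound (leq0n n).
have eS : (n.+1 * n.+1 * L = (n * n.+1 + 0) * L + n.+1 * L)%N by lia.
have -> : r rPtr - r rRow = cell ((n * n.+1 + 0) * L).
  by rewrite H11 h9 /cell; lia.
rewrite !h8 !h4 !h24.
do 4![split; first by rewrite /small /cell; lia].
split=> //; cbn [updr Nat.eqb reg Defs.mem] => //.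
by split=> //; rewrite /cell; lia.
Qed.

Lemma level_run s : level_inv 0 s ->
  runs W X b (WhileLt rX rC level_code) s
    (fun s' => exists2 p, level_inv p s' & (count p < L)%N) (n * 14 + 2).
Proof.
move=> H0.
pose I k s := exists p, (p + k = n)%N /\ level_inv p s.
(* The entry of index [L - 1] is at most [C] exactly when the count reaches [L]. *)
have guard p s' : level_inv p s' -> (reg s' rX < reg s' rC) = (L <= count p)%N.
  move=> [[[_ _ -> _ _] _] [_ _ Hm] [le_p _] [_ -> _ ->]].
  by rewrite ltzD1 Hm //; have := level_bound le_p; lia.
apply: runs_weaken (runs_while words_le (I := I) (j := n) (B := 12%N) _ _) _ _ => //.
- move=> k {}s {H0} [p [Ep Hp]]; rewrite (guard _ _ Hp) => ge_L.
  have lt_p : (p < n)%N.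
    have [_ _ [le_p _] _] := Hp; rewrite ltn_neqAle le_p andbT; apply/eqP => E.
    by move: ge_L; rewrite E; lia.
  split; first by lia.
  have [Hc Hm [_ Hbig] [h16 h17 h23 h21]] := Hp.
  apply: runs_straight => //.
  case: s {Hp} Hc Hm h16 h17 h23 h21 => r mm /= Hc Hm h16 h17 h23 h21.
  have [[h24 h2 h3 h4 h5] [h7 h8 h9 h10 h14]] := Hc.
  rewrite /level_code; cbn [wp updr Nat.eqb reg Defs.mem]; rewrite !h16 !h17 !h8 !h23 !h4.
  have lb := level_bound lt_p.
  have eS : ((n * n.+1 + p.+1) * L = (n * n.+1 + p) * L + L)%N by lia.
  do 3![split; first by rewrite /small /cell; lia].
  exists p.+1; split; first by lia.
  split=> //; cbn [updr Nat.eqb reg Defs.mem] => //.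
  + by split=> // p'; rewrite ltnS leq_eqVlt => /orP[/eqP->|/Hbig].
  + by split=> //; rewrite /cell; lia.
- by exists 0%N.
move=> s1 [[k [p [_ Hp]]]]; rewrite leNgt (guard _ _ Hp) -ltnNge => lt_L.
by exists p.
Qed.

Definition scan_inv (p q : nat) (s : state) : Prop :=
  [/\ consts (reg s), mem_ok (n.+1 * n.+1 * L) (Defs.mem s),
      [/\ (p <= n)%N, forall p', (p' < p)%N -> (L <= count p')%N,
          (count p < L)%N & (q <= count p)%N] &
  [/\ reg s rA = cell ((n * n.+1 + p) * L + q), reg s rY = q%:Z, reg s rT = p%:Z
    & reg s rX = Defs.mem s (reg s rA)]].

Lemma scan_init_run p s : level_inv p s -> (count p < L)%N ->
  runs W X b scan_init_code s (scan_inv p 0) 6.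
Proof.
move=> [Hc Hm [le_p Hbig] [h16 h17 h23 h21]] lt_L; apply: runs_straight => //.
case: s Hc Hm h16 h17 h23 h21 => r mm /= Hc Hm h16 h17 h23 h21.
have [[h24 h2 h3 h4 h5] [h7 h8 h9 h10 h14]] := Hc.
rewrite /scan_init_code; cbn [wp updr Nat.eqb reg Defs.mem]; rewrite !h24.
split; first by rewrite /small; lia.
split=> //; cbn [updr Nat.eqb reg Defs.mem] => //.
by split=> //; rewrite h16 addn0.
Qed.

Lemma scan_run p s : scan_inv p 0 s ->
  runs W X b (WhileLt rX rC scan_code) s (scan_inv p (count p)) (L * 11 + 2).
Proof.
move=> H0; have [_ _ [le_p _ lt_L _] _] := H0; have lb := level_bound le_p.
pose I k s := exists q, (q + k = L)%N /\ scan_inv p q s.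
have guard q s' : scan_inv p q s' -> (reg s' rX < reg s' rC) = (q < count p)%N.
  move=> [[[_ _ -> _ _] _] [_ _ Hm] [_ _ _ le_q] [-> _ _ ->]].
  by rewrite ltzD1 Hm //; lia.
apply: runs_weaken (runs_while words_le (I := I) (j := L) (B := 9%N) _ _) _ _ => //.
- move=> k {}s {H0} [q [Eq Hq]]; rewrite (guard _ _ Hq) => lt_q.
  split; first by lia.
  have [Hc Hm [_ Hbig _ le_q] [h16 h22 h23 h21]] := Hq.
  apply: runs_straight => //.
  case: s {Hq} Hc Hm h16 h22 h23 h21 => r mm /= Hc Hm h16 h22 h23 h21.
  have [[h24 h2 h3 h4 h5] [h7 h8 h9 h10 h14]] := Hc.
  rewrite /scan_code; cbn [wp updr Nat.eqb reg Defs.mem]; rewrite !h16 !h22 !h4.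
  do 2![split; first by rewrite /small /cell; lia].
  exists q.+1; split; first by lia.
  split=> //; cbn [updr Nat.eqb reg Defs.mem] => //.
  by split=> //; rewrite /cell; lia.
- by exists 0%N.
move=> s1 [[k [q [_ Hq]]]]; rewrite leNgt (guard _ _ Hq) -leqNgt => ge_q.
have [_ _ [_ _ _ le_q] _] := Hq.
by have <- : q = count p by lia.
Qed.

(** With [E] and [v] in [rT] and [rY], the value [2 ^ E * v / 2 ^ m.+1] stays equal to [q * 2 ^ p];
    [k] counts the doublings. *)
Definition shift_inv (p q k : nat) (s : state) : Prop :=
  [/\ consts (reg s), (k <= m)%N, (q * 2 ^ k < L)%N,
      reg s rY = (q * 2 ^ k)%N%:Z & reg s rT = (p + (m.+1 - k))%N%:Z].

Lemma shift_run p q s : (0 < q)%N -> (p <= n)%N -> shift_inv p q 0 s ->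
  runs W X b (WhileLt rY rM shift_code) s
    (fun s' => exists k, shift_inv p q k s' /\ (M <= q * 2 ^ k)%N) (m * 8 + 2).
Proof.
move=> q_gt0 le_p H0.
pose I k s := exists k', (k' + k = m)%N /\ shift_inv p q k' s.
apply: runs_weaken (runs_while words_le (I := I) (j := m) (B := 6%N) _ _) _ _ => //.
- move=> j {}s {H0} [k [Ek [Hc le_k lt_L h22 h23]]].
  have [[h24 h2 h3 h4 h5] [h7 h8 h9 h10 h14]] := Hc.
  rewrite h22 h7 => lt_M.
  (* Since [q >= 1], the bound [q * 2 ^ k < M = 2 ^ m] forces [k < m]. *)
  have lt_k : (k < m)%N.
    rewrite -(ltn_exp2l (m := 2)) // -M_pow; apply: leq_ltn_trans (leq_pmull _ q_gt0) _; lia.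
  split; first by lia.
  apply: runs_straight => //.
  case: s Hc h24 h2 h3 h4 h5 h7 h8 h9 h10 h14 h22 h23 => r mm /= Hc h24 h2 h3 h4 h5 h7 h8 h9 h10 h14 h22 h23.
  rewrite /shift_code; cbn [wp updr Nat.eqb reg Defs.mem]; rewrite !h22 !h23 !h4.
  have e2 : (q * 2 ^ k.+1 = q * 2 ^ k + q * 2 ^ k)%N by rewrite expnS; lia.
  have leX : (L <= n.+1 * n.+1 * L)%N by nia.
  do 2![split; first by rewrite /small; lia].
  exists k.+1; split; first by lia.
  by split=> //; cbn [updr Nat.eqb reg Defs.mem] => //; lia.
- by exists 0%N.
move=> s1 [[j [k [_ Hk]]]].
have [[_ [-> _ _ _ _]] _ _ -> _] := Hk => ge_M.
by exists k; split=> //; lia.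
Qed.

(** [p + (m.+1 - k)] is the exponent of the normalised count; beyond [n] it is replaced by [n], with
    a mantissa of ones. The [.-1] is the exponent bias. *)
Definition result (p : nat) (s : state) : Prop :=
  count p = 0%N /\ reg s 0%N = 0 /\ reg s 1%N = 0 \/
  exists k, [/\ (k <= m)%N, (M <= count p * 2 ^ k < L)%N,
     reg s 0%N = (minn n (p + (m.+1 - k))).-1%:Z &
     reg s 1%N = (if (n < p + (m.+1 - k))%N then L.-1 else count p * 2 ^ k)%N%:Z].

Lemma float_run p s : scan_inv p (count p) s ->
  runs W X b float_code s (result p) (m * 8 + 21).
Proof.
move=> [Hc Hm [le_p Hbig lt_L _] [h16 h22 h23 _]].
have [[h24 h2 h3 h4 h5] [h7 h8 h9 h10 h14]] := Hc.
have leX : (L <= n.+1 * n.+1 * L)%N by nia.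
have -> : (m * 8 + 21 = (3 + ((m * 8 + 2) + 14)) + 2)%N by lia.
apply: (runs_if words_le); rewrite h24 h22 => h.
  apply: runs_seq; apply: (runs_weaken (Q := shift_inv p (count p) 0)); last 1 first.
  - exact: leqnn.
  - apply: runs_straight => //.
    case: s Hc Hm h16 h22 h23 h24 h2 h3 h4 h5 h7 h8 h9 h10 h14 => r mm /=.
    move=> Hc Hm h16 h22 h23 h24 h2 h3 h4 h5 h7 h8 h9 h10 h14.
    cbn [wp updr Nat.eqb reg Defs.mem]; rewrite !h23 !h5.
    split; first by rewrite /small; lia.
    by split=> //; cbn [updr Nat.eqb reg Defs.mem] => //; rewrite ?expn0 ?muln1 //; lia.
  move=> s1 H1; apply: runs_seq.
  apply: runs_weaken (shift_run _ le_p H1) _ (leqnn _) => //.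
  move=> s2 [k [[Hc2 le_k lt_k k22 k23] ge_k]].
  apply: (runs_weaken (N := straight_cost write_code)); [|move=> s'; exact: id|by []].
  apply: runs_straight => //.
  case: s2 Hc2 k22 k23 => r mm /= Hc2 k22 k23.
  have [[k24 k2 k3 k4 k5] [k7 k8 k9 k10 k14]] := Hc2.
  rewrite /write_code; cbn [wp updr Nat.eqb reg Defs.mem]; rewrite !k24 !k22 !k23 !k2 !k8 !k4.
  split=> hE.
    do 4![split; first by rewrite /small; lia].
    right; exists k; cbn [updr Nat.eqb reg Defs.mem].
    split=> //; [by rewrite ge_k | lia | case: ifP; lia].
  do 2![split; first by rewrite /small; lia].
  right; exists k; cbn [updr Nat.eqb reg Defs.mem].
  split=> //; [by rewrite ge_k | lia | case: ifP; lia].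
apply: (runs_weaken (N := straight_cost (Add 0 rZ rZ ;; Add 1 rZ rZ))); [|move=> s'; exact: id|rewrite /=; lia].
apply: runs_straight => //.
case: s Hc Hm h16 h22 h23 h24 h2 h3 h4 h5 h7 h8 h9 h10 h14 h => r mm /=.
move=> Hc Hm h16 h22 h23 h24 h2 h3 h4 h5 h7 h8 h9 h10 h14 h.
cbn [wp updr Nat.eqb reg Defs.mem]; rewrite !h24.
do 2![split; first by rewrite /small; lia].
by left; cbn [updr Nat.eqb reg Defs.mem]; split=> //; lia.
Qed.

Lemma knapsack_run s : reg s = (fun=> 0) -> Defs.mem s = mem0 ->
  runs W X b knapsack_code s
    (fun s' => exists p, [/\ (p <= n)%N, forall p', (p' < p)%N -> (L <= count p')%N,
       (count p < L)%N & result p s'])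
    (n * (n.+1 * (82 * M + 22) + 13) + n.+1 * L * 8 + L * 11 + n * 22 + m * 25 + 112).
Proof.
move=> Hr Hm.
apply: (runs_weaken (N := (29 + ((m * 17 + 2) + (9 + ((n * 8 + 2) + (12 +
  ((n.+1 * L * 8 + 2) + ((n * (n.+1 * (82 * M + 22) + 13) + 8) + (15 +
  ((n * 14 + 2) + (6 + ((L * 11 + 2) + (m * 8 + 21))))))))))))%N)); [|move=> s'; exact: id|lia].
apply: runs_seq; apply: runs_weaken (setup_run Hr Hm) _ (leqnn _) => s1 H1.
apply: runs_seq; apply: runs_weaken (digit_run H1) _ (leqnn _) => s2 H2.
apply: runs_seq; apply: runs_weaken (size_run H2) _ (leqnn _) => s3 H3.
apply: runs_seq; apply: runs_weaken (row_size_run H3) _ (leqnn _) => s4 H4.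
apply: runs_seq; apply: runs_weaken (base_run H4) _ (leqnn _) => s5 H5.
apply: runs_seq; apply: runs_weaken (fill_run H5) _ (leqnn _) => s6 H6.
apply: runs_seq; apply: runs_weaken (table_run H6) _ (leqnn _) => s7 H7.
apply: runs_seq; apply: runs_weaken (last_row_run H7) _ (leqnn _) => s8 H8.
apply: runs_seq; apply: runs_weaken (level_run H8) _ (leqnn _) => s9 [p H9 lt_L].
apply: runs_seq; apply: runs_weaken (scan_init_run H9 lt_L) _ (leqnn _) => s10 H10.
apply: runs_seq; apply: runs_weaken (scan_run H10) _ (leqnn _) => s11 H11.
apply: runs_weaken (float_run H11) _ (leqnn _) => s12 H12.
have [_ _ [le_p Hbig lt_L' _] _] := H11; by exists p.
Qed.
End Machine.

(** * Accuracy of the counts *)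

(** The last item is left out or taken. Capacities may turn negative; a selection that overshoots is
    rejected only in the base case. *)
Fixpoint solutions (wt : nat -> nat) (i : nat) (c : int) : nat :=
  if i is i'.+1 then (solutions wt i' c + solutions wt i' (c - (wt i')%:Z)%R)%N
  else (0 <= c)%R.

(** Induction on the number [i] of items allowed: the sets within the first [i.+1] items split by
    membership of item [i], and removing it lowers the capacity by its weight. *)
Lemma knapsack_count_solutions n (w : n.-tuple nat) (C : int) :
  knapsack_count w C = solutions (nth 0%N w) n C.
Proof.
pose wsum (S : {set 'I_n}) := (\sum_(j in S) tnth w j)%N.
pose A i c := [set S : {set 'I_n} | (S \subset [set j : 'I_n | (j < i)%N]) && ((wsum S)%:Z <= c)].
suff HA i c : (i <= n)%N -> #|A i c| = solutions (nth 0%N w) i c.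
  rewrite -HA // /knapsack_count; congr #|pred_of_set _|; apply/setP => S.
  rewrite !inE; suff -> : S \subset [set j : 'I_n | (j < n)%N] by [].
  by apply/fintype.subsetP => j _; rewrite inE ltn_ord.
elim: i c => [|i IH] c lei /=.
  have -> : A 0%N c = if 0 <= c then [set finset.set0] else finset.set0.
    apply/setP => S; rewrite inE.
    have -> : [set j : 'I_n | (j < 0)%N] = finset.set0.
      by apply/setP => j; rewrite !inE.
    rewrite finset.subset0; case: eqP => [->|ne] /=.
      by rewrite /wsum big_set0; case: ifP; rewrite !inE ?eqxx.
    by case: ifP => _; rewrite !inE //; apply/esym/eqP.
  by case: ifP; rewrite ?cards1 ?cards0.
pose o := Ordinal lei.
have wo : tnth w o = nth 0%N w i by rewrite (tnth_nth 0%N).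
have -> : A i.+1 c = A i c :|: [set o |: S | S in A i (c - (nth 0%N w i)%:Z)].
  apply/setP => S; rewrite !inE; apply/idP/idP.
    move=> /andP[/fintype.subsetP HS Hc]; have [oS|oS] := boolP (o \in S); last first.
      apply/orP; left; rewrite Hc andbT; apply/fintype.subsetP => j jS.
      have := HS j jS; rewrite !inE ltnS leq_eqVlt => /orP[/eqP ej|//].
      by move: oS; rewrite (_ : o = j) ?jS //; apply: val_inj.
    apply/orP; right; apply/imsetP; exists (S :\ o); last by rewrite finset.setD1K.
    rewrite inE; apply/andP; split.
      apply/fintype.subsetP => j; rewrite !inE => /andP[ne jS].
      have := HS j jS; rewrite !inE ltnS leq_eqVlt => /orP[/eqP ej|//].
      by case/eqP: ne; apply: val_inj.
    by move: Hc; rewrite /wsum (big_setD1 o) //= wo PoszD addrC -lerBrDr.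
  move=> /orP[/andP[/fintype.subsetP HS Hc]|/imsetP[T]].
    rewrite Hc andbT; apply/fintype.subsetP => j jS.
    by have := HS j jS; rewrite !inE; lia.
  rewrite inE => /andP[/fintype.subsetP HT Hc] ->.
  have oT : o \notin T by apply/negP => /HT; rewrite inE ltnn.
  apply/andP; split.
    apply/fintype.subsetP => j; rewrite !inE => /orP[/eqP -> //|/HT].
    by rewrite inE; lia.
  by rewrite /wsum big_setU1 //= wo PoszD addrC -lerBrDr.
(* Item [o] separates the two families and makes its own insertion injective. *)
have notin d T : T \in A i d -> o \notin T.
  by rewrite inE => /andP[/fintype.subsetP HT _]; apply/negP => /HT; rewrite inE ltnn.
rewrite cardsU finset.disjoint_setI0 ?cards0 ?subn0; last first.
  rewrite disjoint_subset; apply/fintype.subsetP => S /notin oS; rewrite inE.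
  by apply/negP => /imsetP[T _ E]; move: oS; rewrite E finset.setU11.
rewrite card_in_imset ?IH 1?ltnW // => T1 T2 /notin o1 /notin o2 E.
by rewrite -[T1](finset.setU1K o1) -[T2](finset.setU1K o2) E.
Qed.

Lemma solutions_le wt i c : (solutions wt i c <= 2 ^ i)%N.
Proof.
elim: i c => [|i IH] c /=; first by case: (0 <= c).
by rewrite expnS mul2n -addnn leq_add.
Qed.

Section Counts.
Variables (n M : nat) (wt : nat -> nat).

(* At level 0 there is no previous level: the block that happens to precede it in
   memory (level n of the previous row) is halved instead, which is harmless
   since its counts are still lower bounds. *)
Fixpoint row_counts (prev : nat -> int -> nat) (wi : nat) (start : int -> nat)
    (p : nat) (c : int) : nat :=
  maxn (prev p c + prev p (c - wi%:Z)%R)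
    (minn M (if p is p'.+1 then row_counts prev wi start p' c else start c)./2).

Fixpoint counts (i : nat) : nat -> int -> nat :=
  if i is i'.+1 then row_counts (counts i') (wt i') (counts i' n)
  else fun p c => ((p == 0%N) && (0 <= c)%R).

Definition block_count (g : nat) (c : int) : nat :=
  counts (g %/ n.+1) (g %% n.+1) c.

Lemma block_count_init g c : (g <= n)%N ->
  block_count g c = ((g == 0)%N && (0 <= c)) :> nat.
Proof. by move=> le_g; rewrite /block_count divn_small // modn_small. Qed.

Lemma block_countE i p c : (p <= n)%N -> block_count (i * n.+1 + p) c = counts i p c.
Proof.
by move=> le_p; rewrite /block_count divnMDl // divn_small // addn0 modnMDl modn_small.
Qed.

Lemma block_count_rec g c :
  block_count (g + n.+1) c =
  maxn (block_count g c + block_count g (c - (wt (g %/ n.+1))%:Z))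
    (minn M (block_count (g + n) c)./2).
Proof.
have lt_p : (g %% n.+1 < n.+1)%N by rewrite ltn_mod.
have Eb d : block_count g d = counts (g %/ n.+1) (g %% n.+1) d by [].
have Eg := divn_eq g n.+1; rewrite !Eb.
have -> : (g + n.+1 = (g %/ n.+1).+1 * n.+1 + g %% n.+1)%N by rewrite {1}Eg; lia.
rewrite block_countE //.
case E : (g %% n.+1)%N lt_p => [|p] lt_p /=.
  have -> : (g + n = g %/ n.+1 * n.+1 + n)%N by rewrite {1}Eg E; lia.
  by rewrite block_countE.
have -> : (g + n = (g %/ n.+1).+1 * n.+1 + p)%N by rewrite {1}Eg E; lia.
by rewrite block_countE // ltnW.
Qed.

(** Induction on rows, then on levels. Rounding a half down only lowers it, and halving matches the
    factor 2 between levels. At level 0 the halved block is a lower bound for the previous row,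
    whose solutions are among those of this row. *)
Lemma counts_le i p c : (counts i p c * 2 ^ p <= solutions wt i c)%N.
Proof.
elim: i p c => [|i IH] p c /=.
  by case: p => [|p]; rewrite ?muln1 ?mul0n.
have mono d : (solutions wt i d <= solutions wt i d + solutions wt i (d - (wt i)%:Z)%R)%N.
  exact: leq_addr.
elim: p c => [|p IHp] c /=.
  rewrite expn0 muln1 geq_max.
  have := IH 0%N c; have := IH 0%N (c - (wt i)%:Z); rewrite !expn0 !muln1 => h1 h2.
  rewrite leq_add //= (leq_trans (geq_minr _ _)) //.
  have := IH n c; have := expn_gt0 2 n; have := mono c; nia.
rewrite maxnMl geq_max mulnDl leq_add ?IH //=.
have := IHp c; rewrite expnS; set r := row_counts _ _ _ _ _ => h.
apply: leq_trans h; rewrite mulnA leq_mul2r; apply/orP; right; lia.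
Qed.

(** The sum under the maximum already attains the upper bound [counts_le]. *)
Lemma counts_level0 i c : counts i 0 c = solutions wt i c.
Proof.
elim: i c => [|i IH] c; first by rewrite /= .
apply/eqP; rewrite eqn_leq; apply/andP; split.
  by have := counts_le i.+1 0 c; rewrite expn0 muln1.
by rewrite /= leq_max -!IH leqnn.
Qed.

Lemma counts_large i p c : (2 * M <= counts i p c)%N -> (0 < i)%N ->
  (M <= counts i p.+1 c)%N.
Proof.
case: i => // i h _ /=; rewrite leq_max; apply/orP; right.
by rewrite leq_min leqnn /=; move: h => /=; lia.
Qed.

Hypothesis M_gt0 : (0 < M)%N.
Variable R : realType.
Local Notation a := (1 - M%:R^-1 : R).

(** The extra unit on the right absorbs rounding down, so only additions of counts in the range
    above [M] cost a factor. The exponent is [i.-1] because the first item never reaches that range;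
    the factor saved pays for the final rounding. *)
Lemma counts_ge i p c :
  a ^+ i.-1 * (solutions wt i c)%:R < ((counts i p c).+1 * 2 ^ p)%N%:R :> R.
Proof.
have M0 : 0 < M%:R :> R by rewrite ltr0n.
have a_ge0 : 0 <= a by rewrite subr_ge0 invf_le1 // ler1n.
have a_le1 : a <= 1 by rewrite gerBl invr_ge0 ltW.
have p2 k : 0 < (2 ^ k)%N%:R :> R by rewrite ltr0n expn_gt0.
have level0 j d : a ^+ j.-1 * (solutions wt j d)%:R < ((counts j 0 d).+1 * 2 ^ 0)%N%:R :> R.
  rewrite counts_level0 muln1 -natr1; apply: (@le_lt_trans _ _ (solutions wt j d)%:R).
    by rewrite ler_piMl ?ler0n // exprn_ile1.
  by rewrite ltrDl.
(* Halving the previous level loses nothing as long as the count stays below M. *)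
have halve j q d : a ^+ j * (solutions wt j.+1 d)%:R <= (M * 2 ^ q.+1)%N%:R :> R ->
    a ^+ j * (solutions wt j.+1 d)%:R < ((counts j.+1 q d).+1 * 2 ^ q)%N%:R :> R ->
    a ^+ j * (solutions wt j.+1 d)%:R < ((counts j.+1 q.+1 d).+1 * 2 ^ q.+1)%N%:R :> R.
  set x := a ^+ j * _; move=> leM ltq.
  have [le|lt] := leqP M (counts j.+1 q d)./2.
    apply: le_lt_trans leM _; rewrite ltr_nat ltn_pmul2r ?expn_gt0 // ltnS.
    by rewrite /= leq_max (minn_idPl le) leqnn orbT.
  apply: lt_le_trans ltq _; rewrite ler_nat expnS mulnA leq_mul2r; apply/orP; right.
  have : ((counts j.+1 q d)./2 <= counts j.+1 q.+1 d)%N.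
    by rewrite /= leq_max; apply/orP; right; rewrite leq_min (ltnW lt) leqnn.
  lia.
elim: i p c => [|i IH] p c.
  case: p => [|p]; first exact: level0.
  rewrite expr0 mul1r ltr_nat /= expnS.
  have : (0 < 2 ^ p)%N by rewrite expn_gt0.
  by case: (0 <= c) => /=; lia.
elim: p => [|p IHp]; first exact: level0.
have [leM|ltM] := lerP (a ^+ i * (solutions wt i.+1 c)%:R) (M * 2 ^ p.+1)%N%:R.
  exact: halve.
(* One item has at most 2 solutions, and [2 <= M * 2 ^ p.+1], so the large range is empty. *)
case: i IH IHp ltM => [|i] IH IHp ltM.
  move: ltM; rewrite expr0 mul1r ltr_nat ltnNge => /negP[].
  apply: leq_trans (solutions_le _ _ _) _.
  have := expn_gt0 2 p; rewrite (expnS 2 p) /=; nia.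
have h1 : a ^+ i * (solutions wt i.+1 c)%:R < _ := IH p.+1 c.
have h2 : a ^+ i * (solutions wt i.+1 (c - (wt i.+1)%:Z))%:R < _ := IH p.+1 _.
apply: (@lt_le_trans _ _ ((counts i.+1 p.+1 c + counts i.+1 p.+1 (c - (wt i.+1)%:Z)).+1 * 2 ^ p.+1)%N%:R); last first.
  by rewrite ler_nat leq_mul2r; apply/orP; right; rewrite ltnS [in leqRHS]/= leq_max leqnn.
move: ltM h1 h2; set y := a ^+ i * (solutions wt i.+1 c)%:R.
set z := a ^+ i * (solutions wt i.+1 (c - (wt i.+1)%:Z))%:R.
set k1 := counts _ _ _; set k2 := counts _ _ _; set P := (2 ^ p.+1)%N.
have -> : a ^+ (i.+2).-1 * (solutions wt i.+2 c)%:R = a * (y + z).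
  by rewrite [solutions wt i.+2 c]/= natrD exprS -mulrA mulrDr.
move=> ltM h1 h2; rewrite !natrM -!natr1 natrD in ltM h1 h2 *.
(* Above M, the factor a pays for the unit that rounding both counts may lose. *)
have yz : 0 <= y + z by rewrite addr_ge0 // mulr_ge0 ?exprn_ge0 ?ler0n.
have lt_P : P%:R < M%:R^-1 * (y + z).
  rewrite mulrC ltr_pdivlMr // mulrC; apply: lt_le_trans ltM _.
  by rewrite ler_piMl.
rewrite mulrBl mul1r; lra.
Qed.

End Counts.

(** * Floating-point output and word sizes *)

Lemma bits_val_rcons s (c : bool) : bits_val (rcons s c) = ((bits_val s).*2 + c)%N.
Proof. by rewrite /bits_val foldl_rcons. Qed.

Lemma bits_val_surj k v : (v < 2 ^ k)%N -> exists s : k.-tuple bool, bits_val s = v.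
Proof.
elim: k v => [|k IH] v lt_v.
  by exists [tuple]; rewrite /bits_val /=; case: v lt_v.
have [|s Es] := IH v./2; first by move: lt_v; rewrite expnS; lia.
exists [tuple of rcons s (odd v)]; rewrite bits_val_rcons Es; lia.
Qed.

Lemma mantissaE (R : realType) t (s : t.-tuple bool) :
  \sum_(i < t) (tnth s i)%:R * 2 ^- i.+1 = (bits_val s)%:R / 2 ^+ t :> R.
Proof.
under eq_bigr => i _ do rewrite (tnth_nth false) /=.
case: s => s /= /eqP <-.
elim/last_ind: s => [|s c IH]; first by rewrite big_ord0 mul0r.
rewrite size_rcons big_ord_recr /= nth_rcons ltnn eqxx bits_val_rcons.
under eq_bigr => i _ do rewrite nth_rcons ltn_ord.
rewrite IH -mul2n natrD natrM mulrDl; congr (_ + _).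
rewrite exprS invfM mulrACA divff ?mul1r //; lra.
Qed.

Lemma fvalE (R : realType) k t (Z : float k t) :
  fval R Z = 2 ^+ (bits_val (fexp Z)).+1 * (bits_val (fman Z))%:R / 2 ^+ t.
Proof. by rewrite /fval mantissaE mulrA. Qed.

Lemma float_surj k t u v : (u < 2 ^ k)%N -> (v < 2 ^ t)%N ->
  exists Z : float k t, bits_val (fexp Z) = u /\ bits_val (fman Z) = v.
Proof.
move=> /bits_val_surj[x Ex] /bits_val_surj[y Ey].
by exists (Float x y).
Qed.

Lemma words_le_exp W j (x : int) : (0 < W)%N -> (`|x| < 2 ^ (W * j))%N -> (words W x <= maxn 1 j)%N.
Proof.
move=> W_gt0 lt_x; rewrite /words /bitlen /=.
have [->|x_gt0] := posnP `|x|%N; first by rewrite trunc_log0 div0n leq_maxl.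
rewrite leq_max; apply/orP; right; rewrite ltn_divLR // mulnC.
rewrite -(ltn_exp2l _ _ (isT : 1 < 2)%N).
exact: leq_ltn_trans (trunc_logP _ x_gt0) lt_x.
Qed.

Lemma lt_bitlen v : (v < 2 ^ bitlen v)%N.
Proof. exact: trunc_log_ltn. Qed.

(** * Logarithms and binary digits of the precision *)

Section Clog.
Variable R : realType.

(** For [x >= 1] the logarithm is nonnegative, so the absolute value in [clog2] leaves the ceiling
    unchanged. *)
Lemma clog2_le (x : R) j : 1 <= x -> (clog2 x <= j)%N = (x <= 2 ^+ j).
Proof.
move=> x_ge1; have x_gt0 : 0 < x := lt_le_trans ltr01 x_ge1.
have ln2 : 0 < ln 2 :> R by rewrite ln_gt0 // ltr1n.
have log_ge0 : 0 <= log2 x by apply: divr_ge0; [exact: ln_ge0 | exact: ltW].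
have ceil_ge0 : 0 <= Num.ceil (log2 x).
  by rewrite -(ler_int R) (le_trans log_ge0) // ceil_ge.
rewrite /clog2 -lez_nat gez0_abs // ceil_le_int /log2 ler_pdivrMr //.
by rewrite -[in RHS]ler_ln ?posrE ?exprn_gt0 // lnXn // mulr_natl.
Qed.

(** The source of the logarithmic factor in the running time: it bounds how many numbers of the size
    of [n] must be multiplied to reach [1 / e]. *)
Lemma inv_le_log_factor n (e : R) : 0 < e -> e <= 1 ->
  e^-1 <= ((maxn n 2) ^ log_factor n e)%N%:R.
Proof.
move=> e_gt0 e_le1; set N := maxn n 2.
have N_gt1 : 1 < N%:R :> R by rewrite ltr1n leq_max orbT.
have lnN : 0 < ln N%:R :> R by rewrite ln_gt0.
have ln2 : 0 < ln 2 :> R by rewrite ln_gt0 // ltr1n.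
have le_log : log2 e^-1 / log2 N%:R <= (log_factor n e)%:R.
  set r := _ / _; have : r <= (`|Num.ceil r|%N)%:R.
    by rewrite pmulrn; apply: le_trans (ceil_ge r) _; rewrite ler_int lez_abs.
  move/le_trans; apply; rewrite ler_nat; exact: leq_maxr.
move: le_log; rewrite /log2 invfM invrK mulrACA mulVf ?gt_eqF // mulr1.
rewrite ler_pdivrMr // mulr_natl natrX -lnXn ?(lt_trans ltr01) //.
by rewrite ler_ln // posrE ?invr_gt0 // exprn_gt0 // (lt_trans ltr01).
Qed.

(** Doubling a real number doubles its integer part, up to one added unit, and that unit is the
    parity. *)
Lemma digitE (e : R) j : 0 <= e ->
  digit e j.+1 = Num.floor (2 ^+ j.+1 * e) - 2 * Num.floor (2 ^+ j * e) /\
  0 <= digit e j.+1 <= 1.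
Proof.
move=> e_ge0; rewrite /digit exprS -mulrA; set y := 2 ^+ j * e.
have h1 := floor_le y; have h2 := floorD1_gt y.
have h3 := floor_le (2 * y); have h4 := floorD1_gt (2 * y).
have : 2 * Num.floor y < Num.floor (2 * y) + 1.
  rewrite -(ltr_int R) intrM intrD; lra.
have : Num.floor (2 * y) < 2 * (Num.floor y + 1).
  rewrite -(ltr_int R) intrM intrD; lra.
by lia.
Qed.

Lemma digit_le1 (e : R) j : 0 <= digit e j <= 1.
Proof. by rewrite /digit; lia. Qed.

Lemma bernoulli (x : R) n : 0 <= x -> x <= 1 -> 1 - n%:R * x <= (1 - x) ^+ n.
Proof.
move=> x_ge0 x_le1; elim: n => [|n IH]; first by rewrite mul0r subr0 expr0.
rewrite exprS -natr1; apply: le_trans (ler_wpM2l _ IH); last by rewrite subr_ge0.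
have : 0 <= n%:R * x * x by rewrite !mulr_ge0.
by lra.
Qed.

End Clog.

(** * Accuracy of the floating-point result *)

Section Accuracy.
Variables (R : realType) (n m : nat) (e : R) (wt : nat -> nat) (C : int).
Local Notation M := (2 ^ m)%N.
Local Notation L := (2 * M)%N.
Local Notation sol := (solutions wt n C).
Local Notation cnt p := (counts n M wt n p C).
Hypothesis n_gt0 : (0 < n)%N.
Hypothesis e_gt0 : 0 < e.
Hypothesis e_le1 : e <= 1.
Hypothesis M_ge : n%:R / e <= M%:R.

Let M_gt0 : (0 < M)%N. Proof. by rewrite expn_gt0. Qed.

Let n_le_eM : n%:R <= e * M%:R.
Proof. by move: M_ge; rewrite ler_pdivrMr // mulrC. Qed.

Lemma count_le_solutions p : (cnt p)%:R * 2 ^+ p <= sol%:R :> R.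
Proof. by rewrite -natrX -natrM ler_nat counts_le. Qed.

(** Level 0 is exact. At a later level the previous count reached [2 * M], so this one is at least
    [M], and one more factor [1 - 1/M] removes the extra unit of [counts_ge]. *)
Lemma count_accuracy p : (forall p', (p' < p)%N -> (L <= cnt p')%N) ->
  (1 - e) * sol%:R <= (cnt p)%:R * 2 ^+ p.
Proof.
case: p => [_|p Hbig].
  by rewrite counts_level0 expr0 mulr1 ler_piMl ?ler0n // gerBl ltW.
have leM : (M <= cnt p.+1)%N by apply: counts_large => //; exact: Hbig.
have := counts_ge n wt M_gt0 R n p.+1 C; set c := cnt p.+1 in leM *.
have M0 : 0 < M%:R :> R by rewrite ltr0n.
set a := 1 - M%:R^-1 => lt_sol.
have a_ge0 : 0 <= a by rewrite subr_ge0 invf_le1 // ler1n.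
(* By Bernoulli the [n]-th power of [a] is at least [1 - n / M], and [n / M <= e]. *)
have le_e : 1 - e <= a * a ^+ n.-1.
  rewrite -exprS prednK //; apply: le_trans (bernoulli n _ _).
  - by rewrite lerB // ler_pdivrMr.
  - by rewrite invr_ge0 ltW.
  - by rewrite invf_le1 // ler1n.
apply: le_trans (ler_wpM2r _ le_e) _ => //.
rewrite -mulrA; apply: le_trans (ler_wpM2l a_ge0 (ltW lt_sol)) _.
rewrite natrM natrX mulrA ler_wpM2r ?exprn_ge0 //.
rewrite /a mulrBl mul1r lerBlDr -natr1 lerD2l ler_pdivlMl // mulr1.
by rewrite natr1 ler_nat leqW.
Qed.

Lemma result_float p k t (s : state) : (n <= 2 ^ k)%N -> t = m.+1 -> (p <= n)%N ->
  (forall p', (p' < p)%N -> (L <= cnt p')%N) ->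
  result n m M C (block_count n M wt) p s ->
  exists Z : float k t,
    [/\ output s Z, (1 - e) * sol%:R <= fval R Z & fval R Z <= sol%:R].
Proof.
move=> le_nk -> le_p Hbig; rewrite /result block_countE // => Hres.
have acc := count_accuracy Hbig; have upp := count_le_solutions p.
case: Hres => [[c0 [Hu Hv]]|[j [le_j /andP[geM ltL] Hu Hv]]].
  have [||Z [Zu Zv]] := @float_surj k m.+1 0 0; try by rewrite expn_gt0.
  exists Z; rewrite fvalE Zv mulr0 mul0r ler0n; split=> //.
    by split; rewrite ?Zu ?Zv.
  by move: acc; rewrite c0 mul0r.
set E := (p + (m.+1 - j))%N in Hu Hv; set q := (cnt p * 2 ^ j)%N in geM ltL Hv.
(* Normalisation does not change the value. *)
have Eval : (cnt p)%:R * 2 ^+ p = 2 ^+ E * q%:R / 2 ^+ m.+1 :> R.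
  have -> : 2 ^+ m.+1 = 2 ^+ (m.+1 - j) * 2 ^+ j :> R by rewrite -exprD subnK // leqW.
  rewrite /E exprD /q natrM natrX.
  have h1 : (2 : R) ^+ j != 0 by rewrite expf_neq0.
  have h2 : (2 : R) ^+ (m.+1 - j) != 0 by rewrite expf_neq0.
  by field; rewrite h1 h2.
have E_gt0 : (0 < E)%N by rewrite /E; lia.
have L0 : 0 < 2 ^+ m.+1 :> R by rewrite exprn_gt0.
(* If [E > n], the normalised value is at least [2 ^ n], which also bounds the number of solutions.
   The float written is [2 ^ n * (1 - 1/L)], and [1/L <= e] because [n <= e * M]. *)
case: (ltnP n E) Hu Hv => [lt_E|le_E] Hu Hv.
  have [||Z [Zu Zv]] := @float_surj k m.+1 n.-1 L.-1; first lia.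
    by rewrite expnS prednK // muln_gt0.
  exists Z; rewrite fvalE Zu Zv prednK //; split; first by split; rewrite ?Zu ?Zv.
  - apply: le_trans (_ : (1 - e) * 2 ^+ n <= _).
      rewrite ler_wpM2l ?subr_ge0 // -natrX ler_nat; exact: solutions_le.
    rewrite mulrC -mulrA ler_wpM2l ?exprn_ge0 // ler_pdivlMr //.
    have -> : L.-1%:R = 2 ^+ m.+1 - 1 :> R.
      by rewrite -subn1 natrB ?muln_gt0 // natrM natrX -exprS.
    have : 1 <= n%:R :> R by rewrite ler1n.
    have -> : 2 ^+ m.+1 = 2 * M%:R :> R by rewrite exprS natrX.
    by have := n_le_eM; lra.
  - apply: le_trans upp; rewrite Eval !ler_pdivrMr // mulfVK ?gt_eqF //.
    apply: (@le_trans _ _ (2 ^+ n * L%:R)).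
      by rewrite ler_wpM2l ?exprn_ge0 // ler_nat leq_pred.
    rewrite natrM mulrA -exprSr ler_pM ?exprn_ge0 ?ler0n // ?ler_nat //.
    by rewrite ler_weXn2l // ler1n.
have [||Z [Zu Zv]] := @float_surj k m.+1 E.-1 q; first lia.
  by rewrite expnS.
exists Z; rewrite fvalE Zu Zv prednK // -Eval.
by split=> //; split; rewrite ?Zu ?Zv.
Qed.

End Accuracy.

(** * Word sizes and running time *)

Section Size.
Variables (R : realType) (n : nat) (e : R) (w : n.-tuple nat) (C : int).
Hypothesis n_gt0 : (0 < n)%N.
Hypothesis e_gt0 : 0 < e.
Hypothesis e_le1 : e <= 1.
Local Notation m := (clog2 (n%:R / e)).
Local Notation M := (2 ^ m)%N.
Local Notation W := (word_size w C).
Local Notation lf := (log_factor n e).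
Local Notation wmax := (\max_(i < n) tnth w i)%N.

Lemma ratio_ge1 : 1 <= n%:R / e.
Proof. by rewrite ler_pdivlMr // mul1r (le_trans e_le1) // ler1n. Qed.

Lemma pow_clog2_ge : n%:R / e <= M%:R.
Proof. by rewrite natrX -clog2_le // ratio_ge1. Qed.

Lemma pow_clog2_le : M%:R <= 2 * (n%:R / e).
Proof.
have ge1 := ratio_ge1; case E : m => [|k].
  by rewrite expn0; lra.
rewrite expnS natrM ler_wpM2l // natrX ltW // ltNge -clog2_le // E.
by rewrite ltnn.
Qed.

Lemma lt_word v : (v <= maxn (maxn n `|C|) wmax)%N -> (v < 2 ^ W)%N.
Proof.
move=> le_v; apply: leq_ltn_trans le_v (leq_trans (lt_bitlen _) _).
by rewrite leq_exp2l.
Qed.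

Definition number_bound : nat :=
  (n.+1 * n.+1 * (2 * M) + 2 * n + 10 + `|C| + wmax)%N.

(** With [Q = 2 ^ W] above [n], the capacity and all weights, [M] is at most [2 * n * Q ^ lf], so
    the table has at most [4 * Q ^ (lf + 3)] cells; the remaining powers of [Q >= 2] absorb
    constants and smaller terms. *)
Lemma number_bound_lt : (number_bound < 2 ^ (W * (lf + 8)))%N.
Proof.
have lt_n : (n < 2 ^ W)%N by apply: lt_word; rewrite !leq_max leqnn.
have lt_C : (`|C| < 2 ^ W)%N by apply: lt_word; rewrite !leq_max leqnn !orbT.
have lt_w : (wmax < 2 ^ W)%N by apply: lt_word; rewrite !leq_max leqnn !orbT.
have leM : (M <= 2 * n * (maxn n 2) ^ lf)%N.
  rewrite -(ler_nat R) !natrM; apply: le_trans pow_clog2_le _.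
  by rewrite mulrA ler_wpM2l ?mulr_ge0 ?ler0n //; apply: inv_le_log_factor.
have Q_ge2 : (2 <= 2 ^ W)%N by apply: leq_ltn_trans n_gt0 lt_n.
have leN : (maxn n 2 <= 2 ^ W)%N by rewrite geq_max Q_ge2 ltnW.
rewrite expnM; move: lt_n lt_C lt_w Q_ge2 leN; rewrite /number_bound.
set Q := (2 ^ W)%N => lt_n lt_C lt_w Q_ge2 leN.
have {}leM : (M <= 2 * n * Q ^ lf)%N.
  apply: leq_trans leM _; rewrite leq_mul2l leq_exp2r ?leN ?orbT //.
  by rewrite /log_factor leq_max.
rewrite expnD; set y := (Q ^ lf)%N in leM *.
have y_ge : (Q <= y)%N.
  by rewrite -[X in (X <= _)%N]expn1 leq_pexp2l ?leq_max // (leq_trans _ Q_ge2).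
have lt1 : (n.+1 * n.+1 * (2 * M) <= Q * Q * (4 * Q * y))%N.
  by apply: leq_mul; [apply: leq_mul | nia].
have E8 : (Q ^ 8 = Q * Q * Q * (Q * Q * Q * Q * Q))%N by rewrite !expnS expn0; lia.
have Q3 : (8 <= Q * Q * Q)%N by nia.
have Q5 : (32 <= Q * Q * Q * Q * Q)%N by nia.
rewrite E8; move: lt1 Q3 Q5.
have -> : (Q * Q * (4 * Q * y) = 4 * (Q * Q * Q * y))%N by lia.
set u := (Q * Q * Q)%N; set v := (Q * Q * Q * Q * Q)%N => lt1 Q3 Q5.
have h1 : (u * y * 32 <= u * y * v)%N by rewrite leq_mul2l Q5 orbT.
have h2 : (8 * y <= u * y)%N by rewrite leq_mul2r Q3 orbT.
have -> : (y * (u * v) = u * y * v)%N by lia.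
lia.
Qed.

(** [lf + 8] words suffice, and [lf >= 1] turns the sum into a multiple of [lf]. *)
Lemma words_le_log_factor x : (`|x| <= number_bound)%N -> (words W x <= 9 * lf)%N.
Proof.
move=> le_x; have lf_gt0 : (0 < lf)%N by rewrite /log_factor leq_max.
apply: (@leq_trans (maxn 1 (lf + 8))); last by lia.
by apply: words_le_exp => //; apply: leq_ltn_trans le_x number_bound_lt.
Qed.

Lemma nth_weight_le i : (nth 0%N w i <= wmax)%N.
Proof.
have [lt_i|ge_i] := ltnP i n; last by rewrite nth_default // size_tuple.
by have := leq_bigmax (F := tnth w) (Ordinal lt_i); rewrite (tnth_nth 0%N).
Qed.

Lemma all_small_init : all_small number_bound (init w C e).
Proof.
split=> [x|[[|[|i]]|j]] /=; rewrite /small /number_bound; try lia.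
  by have := nth_weight_le i; lia.
by have := digit_le1 e j; lia.
Qed.

Let V (j : nat) : nat := `|Num.floor (2 ^+ j * e)|%N.

Let V_floor j : (V j)%:Z = Num.floor (2 ^+ j * e).
Proof. by rewrite /V gez0_abs // floor_ge0 mulr_ge0 ?exprn_ge0 // ltW. Qed.

Lemma knapsack_code_runs : exists s k,
  [/\ exec W knapsack_code (init w C e) s k,
      (k <= 434 * (n * n * M) * (9 * lf))%N
    & exists Z : float (clog2 (n%:R : R)) (1 + m),
      [/\ output s Z, (1 - e) * (knapsack_count w C)%:R <= fval R Z
        & fval R Z <= (knapsack_count w C)%:R]].
Proof.
have M_gt0 : (0 < M)%N by rewrite expn_gt0.
pose wt := nth 0%N w.
have V_le j : (V j.+1 <= 2 * V j + 1)%N.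
  by have [] := digitE j (ltW e_gt0); rewrite -!V_floor; lia.
(* Both sides say [2 ^ j < n / e]: the first since [n] is an integer, the second by the definition
   of [m] as a rounded-up logarithm. *)
have V_lt j : (V j < n)%N = (j < m)%N.
  rewrite [RHS]ltnNge clog2_le ?ratio_ge1 // -ltNge ltr_pdivlMr //.
  by rewrite -[LHS]ltz_nat V_floor floor_lt_int.
(* As [0 < e <= 1], the integer part of [e] is 0 or 1, hence equal to its own digit. *)
have V_init : Defs.mem (init w C e) (- 1) = (V 0)%:Z.
  rewrite /= /digit V_floor expr0 mul1r modz_small //.
  by rewrite floor_ge0 ltW //= floor_lt_int (le_lt_trans e_le1) // ltr1n.
have V_rec j : Defs.mem (init w C e) (- j.+2%:Z) = (V j.+1)%:Z - (2 * V j)%:Z.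
  by have [] := digitE j (ltW e_gt0); rewrite /= -!V_floor PoszM.
(* There are at most [2 ^ n] solutions, so the count at level [n] is at most 1 and the search for a
   level stops. *)
have last_lt : (block_count n M wt (n * n.+1 + n) C < 2 * M)%N.
  rewrite block_countE //; have := counts_le n M wt n n C.
  have := solutions_le wt n C; have : (0 < 2 ^ n)%N by rewrite expn_gt0.
  by nia.
have mem_wt i : (i < n)%N -> Defs.mem (init w C e) i.+2%:Z = (wt i)%:Z by [].
have mem_cell k : Defs.mem (init w C e) (n.+2 + k)%:Z = 0.
  by rewrite /= nth_default // size_tuple leq_addr.
have [] := knapsack_run words_le_log_factor (erefl M) n_gt0 nth_weight_le
  (mem0 := Defs.mem (init w C e)) erefl erefl mem_wt mem_cell V_le V_lt V_init V_rec (leqnn _)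
  (block_count_init M wt) (block_count_rec n M wt) last_lt (s := init w C e) erefl erefl all_small_init.
move=> s [k [Hex Hk _ [p [le_p Hbig _ Hres]]]].
exists s, k; split=> //.
  (* 434 is the sum of the coefficients of the expanded running time, each monomial being at most
     [n * n * M]. *)
  apply: leq_trans Hk _; rewrite leq_mul2r; apply/orP; right.
  have lt_m : (m < M)%N by rewrite ltn_expl.
  have h1 : (n <= n * n)%N by rewrite leq_pmull.
  have h2 : (n * n <= n * n * M)%N by rewrite leq_pmulr.
  have h3 : (n * M <= n * n * M)%N by rewrite leq_mul2r h1 orbT.
  have h4 : (M <= n * M)%N by rewrite leq_pmull.
  by lia.
rewrite knapsack_count_solutions; apply: (result_float n_gt0 e_gt0 e_le1 pow_clog2_ge _ _ le_p _ Hres) => //.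
  by rewrite -(ler_nat R) natrX -clog2_le // ler1n.
move=> p' lt_p'; rewrite -block_countE ?Hbig //.
exact: ltnW (leq_trans lt_p' le_p).
Qed.

End Size.

Theorem theorem4 (R : realType) :
  exists (P : cmd) (K : nat),
    forall (n : nat) (e : R) (w : n.-tuple nat) (C : int),
      (1 <= n)%N -> 0 < e -> e <= 1 ->
      exists (Z : float (clog2 (n%:R : R)) (1 + clog2 (n%:R / e)))
             (s : state) (k : nat),
        [/\ exec (word_size w C) P (init w C e) s k,
            output s Z,
            (1 - e) * (knapsack_count w C)%:R <= fval R Z,
            fval R Z <= (knapsack_count w C)%:R
          & k%:R <= K%:R * (n%:R ^+ 3 * e^-1 * (log_factor n e)%:R) ].
Proof.
(* [7812 = 434 * 2 * 9]: the factor 2 comes from [M <= 2 * n / e], the 9 from the words per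
   operand. *)
exists knapsack_code, 7812%N => n e w C n_gt0 e_gt0 e_le1.
have [s [k [Hex Hk [Z [HZ lo up]]]]] := knapsack_code_runs w C n_gt0 e_gt0 e_le1.
exists Z, s, k; split=> //.
apply: (@le_trans _ _ (434 * (n * n * 2 ^ clog2 (n%:R / e)) * (9 * log_factor n e))%N%:R).
  by rewrite ler_nat.
rewrite !natrM.
have := pow_clog2_le n_gt0 e_gt0 e_le1; set M := (2 ^ _)%N%:R => leM.
have -> : 7812%:R * (n%:R ^+ 3 * e^-1 * (log_factor n e)%:R) =
    434%:R * (n%:R * n%:R * (2 * (n%:R / e))) * (9%:R * (log_factor n e)%:R) :> R by ring.
by rewrite ler_wpM2r ?mulr_ge0 ?ler0n // ler_wpM2l ?ler0n // ler_wpM2l ?mulr_ge0 ?ler0n.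
Qed.
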